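(* Let $p$ range over primes $p>3$ (for each function below, over those $p$ for which it is defined, i.e. $p$ does not divide the denominator of $n$). (i) For $n\in\{5,-4,\tfrac15,\tfrac45,\tfrac54,-\tfrac14\}$, the functions $p\mapsto F_p(0,1,n)\bmod 16$ are pairwise equivalent. (ii) The function $p\mapsto F_p(0,1,5)\bmod 16$ is equivalent to $p\mapsto\prod_{0<i<j<p/2,\ p\nmid f(i,j)}\big(\frac{f(i,j)}{p}\big)$ for each of the forms $f(i,j)=i^2+ij-j^2,\ i^2+3ij+j^2,\ i^2-3ij+j^2,\ 4i^2+j^2,\ i^2+4j^2,\ 5i^2-j^2,\ i^2-5j^2$. (iii) The function $p\mapsto F_p(0,1,5)\bmod 16$ is also equivalent to $p\mapsto\prod_{i,j=1,\ p\nmid i^2-ij-j^2}^{(p-1)/2}\big(\frac{i^2-ij-j^2}{p}\big)$. (iv) $p\mapsto F_p(0,1,5)\bmod 16$ and all the products in (ii) and (iii) are periodic functions of $p$.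
   Context: $\big(\frac{\cdot}{p}\big)$ is the Legendre symbol; products are over integers $i,j$. For a rational $n$ whose denominator is prime to $p$, $F_p(0,1,n)=\sum_{y=1}^{p}\big(\frac{y(y+1)(y+w)}{p}\big)$ where $w$ is an integer with $w\equiv n\pmod p$; ''$\bmod 16$'' denotes the least nonnegative residue modulo $16$. A function $g$ on a set of primes is periodic if there is $m\in\mathbb Z_{>0}$ with $g(p_1)=g(p_2)$ whenever $p_1\equiv p_2\pmod m$ lie in its domain. Two functions $g,h$ on sets of primes are equivalent if there is $m\in\mathbb Z_{>0}$ such that for each $r$ with $1\le r<m$, $\gcd(r,m)=1$, there is a degree-one polynomial $f_r$ with rational coefficients such that $g(p)=f_r(h(p))$ for all primes $p$ in the common domain with $p\equiv r\pmod m$. *)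

(* Defs.v *)
From mathcomp Require Import all_boot all_order all_algebra.

Set Implicit Arguments.
Unset Strict Implicit.
Unset Printing Implicit Defensive.

Import Order.TTheory GRing.Theory Num.Theory.

Local Open Scope ring_scope.

Definition legendre (p : nat) (a : int) : int :=
  if (p %| a)%Z then 0
  else if [exists x : 'I_p, (x%:Z ^+ 2 == a %[mod p])%Z] then 1 else -1.

(* F_p(0,1,w) for an integer w. *)
Definition F01int (p : nat) (w : int) : int :=
  \sum_(1 <= y < p.+1) legendre p (y%:Z * (y%:Z + 1) * (y%:Z + w)).

(* F_p(0,1,n) for rational n.  The integer w congruent to n modulo p is taken
   to be the representative in [0, p) of the image of n in 'F_p; by
   [F01_indep] below any other choice gives the same sum. *)
Definition F01 (p : nat) (n : rat) : int :=
  F01int p ((ratr n : 'F_p) : nat)%:Z.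

(* A partial function on the primes; only its values at the primes belonging
   to [pdom] are meaningful. *)
Record prime_fun := PrimeFun { pdom : pred nat; pval :> nat -> int }.

Definition periodic (g : prime_fun) : Prop :=
  exists2 m : nat, (0 < m)%N &
    forall p1 p2 : nat, prime p1 -> prime p2 -> pdom g p1 -> pdom g p2 ->
      p1 = p2 %[mod m] -> g p1 = g p2.

(* The modulus is required to exceed 1: for m = 1 there is no r with
   1 <= r < m, and the condition would hold vacuously for all g and h.
   [size f = 2] says that f has degree one, i.e. nonzero slope. *)
Definition equivalent (g h : prime_fun) : Prop :=
  exists2 m : nat, (1 < m)%N &
    forall r : nat, (1 <= r < m)%N -> coprime r m ->
      exists2 f : {poly rat}, size f = 2%N &
        forall p : nat, prime p -> pdom g p -> pdom h p -> p = r %[mod m] ->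
          (g p)%:~R = f.[(h p)%:~R].

Definition F01mod16 (n : rat) : prime_fun :=
  PrimeFun [pred p : nat | (3 < p)%N && ~~ (p %| denq n)%Z]
           (fun p => (F01 p n %% 16)%Z).

(* The triple (a, b, c) encodes the binary form a i^2 + b i j + c j^2. *)
Definition qform (f : int * int * int) (i j : nat) : int :=
  let: (a, b, c) := f in a * i%:Z ^+ 2 + b * (i%:Z * j%:Z) + c * j%:Z ^+ 2.

(* 0 < i < j < p/2, where p/2 is not truncated. *)
Definition prod_triangle (f : int * int * int) : prime_fun :=
  PrimeFun [pred p : nat | (3 < p)%N]
    (fun p => \prod_(1 <= j < p | (j.*2 < p)%N)
                \prod_(1 <= i < j | ~~ (p %| qform f i j)%Z)
                  legendre p (qform f i j)).

Definition prod_square (f : int * int * int) : prime_fun :=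
  PrimeFun [pred p : nat | (3 < p)%N]
    (fun p => \prod_(1 <= i < (p.-1)./2.+1)
                \prod_(1 <= j < (p.-1)./2.+1 | ~~ (p %| qform f i j)%Z)
                  legendre p (qform f i j)).

Lemma legendre_mod (p : nat) (a b : int) :
  (a = b %[mod p])%Z -> legendre p a = legendre p b.
Proof.
move=> ab; rewrite /legendre.
have -> : (p %| a)%Z = (p %| b)%Z.
  by apply/idP/idP => /dvdz_mod0P h; apply/dvdz_mod0P; rewrite -h ?ab.
by under eq_existsb => x do rewrite ab.
Qed.

Lemma F01_indep (p : nat) (n : rat) (w : int) :
  prime p -> ~~ (p %| denq n)%Z -> (p %| numq (w%:~R - n))%Z ->
  F01int p w = F01 p n.
Proof.
move=> pp pd pw.
have Fint (z : int) : ((z%:~R : 'F_p) == 0) = (p %| z)%Z.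
  case: z => k; rewrite ?NegzE ?rmorphN /= ?oppr_eq0 ?dvdzN //=.
    by rewrite -[_%:~R]/(k%:R) -(dvdn_pcharf (pchar_Fp pp)).
  by rewrite -[_%:~R]/(k.+1%:R) -(dvdn_pcharf (pchar_Fp pp)).
have d0 : ((denq n)%:~R : 'F_p) != 0 by rewrite Fint.
have dvd : (p %| w * denq n - numq n)%Z.
  set q := w%:~R - n in pw.
  have e : (w * denq n - numq n) * denq q = numq q * denq n.
    apply: (@intr_inj rat); rewrite !rmorphM rmorphB rmorphM /= !numqE /q.
    by rewrite -mulrBl -!mulrA [X in _ * X]mulrC.
  have dq : (denq q %| denq n)%Z.
    rewrite -(@Gauss_dvdzr _ (numq q)) -?e ?dvdz_mull //.
    by rewrite coprimez_sym /coprimez /gcdz; have := coprime_num_den q => /eqP->.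
  have [k dk] := dvdzP dq.
  suff -> : w * denq n - numq n = numq q * k by rewrite dvdz_mulr.
  by apply: (mulIf (denq_neq0 q)); rewrite e dk mulrA.
have ew : (ratr n : 'F_p) = w%:~R.
  rewrite /ratr; apply: (mulIf d0); rewrite mulfVK //.
  by apply/eqP; rewrite eq_sym -rmorphM -subr_eq0 -rmorphB Fint.
have mw : (w = ((ratr n : 'F_p) : nat)%:Z %[mod p])%Z.
  apply/eqP; rewrite eqz_mod_dvd -Fint rmorphB /= subr_eq0 -ew.
  by rewrite -[X in _ == X]/((ratr n : 'F_p)%:R) natr_Zp.
rewrite /F01 /F01int; apply: eq_bigr => y _; apply: legendre_mod.
by rewrite -modzMmr -[in RHS]modzMmr -modzDmr mw modzDmr.
Qed.

(* Main.v *)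
From Stdlib Require Classical_Prop.
Require Import Defs.
From mathcomp Require Import all_boot all_order all_fingroup all_algebra all_solvable all_field.
From mathcomp Require Import ring zify.

Set Implicit Arguments.
Unset Strict Implicit.
Unset Printing Implicit Defensive.

Import Order.TTheory GRing.Theory Num.Theory.

Local Open Scope ring_scope.

(* Two periodic functions are equivalent, through polynomials [X + c], so it suffices
   to see that, apart from [p = 5], all values depend only on [p] modulo 80.

   Let [chi] be the quadratic character of [F_p].  The number [n] of [x] with
   prescribed signs [chi x], [chi (x-1)], [chi (x-e)] satisfies
   [8 n = p + ... +- sum_x chi (x(x-1)(x-e))] with elementary terms omitted, so that
   [F_p(0,1,e)] modulo 16 and the parity of [n] determine each other.  The six values
   of [n] in (i) give the same sum up to an elementary sign, by the substitutions
   [y -> -1-y] and [y -> y/n].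

   For [e = 1/5] the parity of [n] is the quadratic character of a product which
   [prod_(t nonresidue) (z - t) = z^h + 1], [h = (p-1)/2], evaluates at [z = phi^2],
   [phi] the golden ratio, as [phi^h + phi^-h] up to a known factor.  The character of
   that number is computed in an algebraic closure of [F_p] from
   [phi sqrt 5 = -(zeta - 1/zeta)^2], [zeta^5 = 1].

   By Gauss's lemma and the variant [prod_sign_half_abs] of it, grouping the pairs
   [(i, j)] by the ratio [i / j] turns the products over [i < j] into products of
   [chi (a x + c)] over the [x] with [chi x = 1] and [chi (x-1) = -1]: again a parity
   of a pattern count for one of the six curves.  The product in (iii) becomes
   [prod_(chi (-t) = -1) chi (t^2 - t - 1)], which is evaluated directly. *)

(** * The quadratic character of a finite field *)

(** Euler's criterion serves as the definition; [chi_sqrtP] identifies the value 1 with the nonzero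
    squares. *)
Definition chi (F : finFieldType) (x : F) : int :=
  if x == 0 then 0 else if x ^+ #|F|./2 == 1 then 1 else -1.

Section QuadraticCharacter.

Variable F : finFieldType.
Hypothesis oddF : odd #|F|.
Implicit Types x y a b : F.

Local Notation h := (#|F|./2).

Lemma card_half : #|F| = h.*2.+1.
Proof. by rewrite -[LHS]odd_double_half oddF. Qed.

Lemma half_gt0 : (0 < h)%N.
Proof. by have := finNzRing_gt1 F; rewrite card_half; case: (h). Qed.

(** In characteristic 2 the additive group is a 2-group, so the order would be even. *)
Lemma two_neq0 : (2 : F) != 0.
Proof.
apply/negP => F2; have [p p_pr pF] := finPcharP F.
have p2 : p = 2%N.
  have : 2%N \in [pchar F] by rewrite inE /= F2.
  by rewrite (pcharf_eq pF) => /eqP.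
have := abelem_pgroup (fin_ring_pchar_abelem pF).
rewrite p2 /pgroup cardsT => /p_natP [[|n] e].
  by have := finNzRing_gt1 F; rewrite e.
by move: oddF; rewrite e expnS oddM.
Qed.

Lemma neg1_neq1 : (-1 : F) != 1.
Proof. by rewrite eq_sym -subr_eq0 opprK two_neq0. Qed.

Lemma expf_double_half x : x != 0 -> x ^+ h ^+ 2 = 1.
Proof.
move=> x0; apply: (mulfI x0); rewrite mulr1 -exprM muln2 -exprS -card_half.
exact: expf_card.
Qed.

Lemma expf_half x : x != 0 -> x ^+ h = 1 \/ x ^+ h = -1.
Proof.
move=> x0; have /eqP := expf_double_half x0.
by rewrite sqrf_eq1 => /orP[] /eqP; [left | right].
Qed.

Lemma chiE x : (chi x)%:~R = x ^+ h :> F.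
Proof.
rewrite /chi; case: eqVneq => [->|x0]; first by rewrite expr0n (gtn_eqF half_gt0).
by case: (expf_half x0) => ->; rewrite ?eqxx // (negPf neg1_neq1).
Qed.

Lemma chi0 : chi (0 : F) = 0. Proof. by rewrite /chi eqxx. Qed.
Lemma chi1 : chi (1 : F) = 1.
Proof. by rewrite /chi oner_eq0 expr1n eqxx. Qed.

Lemma chi_pm x : x != 0 -> chi x = 1 \/ chi x = -1.
Proof. by rewrite /chi => /negPf ->; case: ifP; [left | right]. Qed.

Lemma chi_eq0 x : (chi x == 0) = (x == 0).
Proof. by rewrite /chi; case: (eqVneq x 0) => // x0; case: ifP. Qed.

Lemma chi_sqr1 x : x != 0 -> chi x * chi x = 1.
Proof. by move=> /chi_pm[] ->. Qed.

Definition sgn_val (e : int) := [\/ e = 0, e = 1 | e = -1].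

Lemma chi_sgn x : sgn_val (chi x).
Proof.
have [->|/chi_pm[] ->] := eqVneq x 0; first by rewrite chi0; constructor 1.
- by constructor 2.
- by constructor 3.
Qed.

(** In odd characteristic 0, 1 and -1 stay distinct, so identities between signs can be checked in
    [F], where [chi] is a power. *)
Lemma sgn_val_inj (e f : int) :
  sgn_val e -> sgn_val f -> (e%:~R : F) = f%:~R -> e = f.
Proof.
have N1 : (1 : F) != -1 by rewrite eq_sym neg1_neq1.
have N2 := neg1_neq1.
have N3 : (0 : F) != -1 by rewrite eq_sym oppr_eq0 oner_eq0.
have N4 : (-1 : F) != 0 by rewrite oppr_eq0 oner_eq0.
have N5 : (0 : F) != 1 by rewrite eq_sym oner_eq0.
have N6 : (1 : F) != 0 by rewrite oner_eq0.
by case=> -> [] -> //= /eqP; rewrite ?mulrN1z ?mulr1z ?mulr0z ?(negPf N1)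
  ?(negPf N2) ?(negPf N3) ?(negPf N4) ?(negPf N5) ?(negPf N6).
Qed.

Lemma sgn_valM (e f : int) : sgn_val e -> sgn_val f -> sgn_val (e * f).
Proof.
by case=> -> [] ->; first [by constructor 1 | by constructor 2 | by constructor 3].
Qed.

Lemma chiM x y : chi (x * y) = chi x * chi y.
Proof.
apply: sgn_val_inj; [exact: chi_sgn | by apply: sgn_valM; apply: chi_sgn |].
by rewrite rmorphM /= !chiE exprMn.
Qed.

Lemma chi_uniq x (e : int) : sgn_val e -> x ^+ h = e%:~R -> chi x = e.
Proof. by move=> se xe; apply: sgn_val_inj => //; rewrite ?chiE //; apply: chi_sgn. Qed.

Lemma chiV x : chi x^-1 = chi x.
Proof.
have [->|x0] := eqVneq x 0; first by rewrite invr0.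
have xV0 : x^-1 != 0 by rewrite invr_eq0.
have : chi x^-1 * chi x = 1 by rewrite -chiM mulVf // chi1.
by case: (chi_pm x0) => ->; case: (chi_pm xV0) => ->.
Qed.

Lemma chi_sqr x : x != 0 -> chi (x ^+ 2) = 1.
Proof. by move=> x0; rewrite expr2 chiM chi_sqr1. Qed.

Lemma chiX x n : chi (x ^+ n) = chi x ^+ n.
Proof.
by elim: n => [|n IH]; rewrite ?expr0 ?chi1 // !exprS chiM IH.
Qed.

Lemma chi_prod (I : Type) (r : seq I) (P : pred I) (f : I -> F) :
  chi (\prod_(i <- r | P i) f i) = \prod_(i <- r | P i) chi (f i).
Proof. exact: (big_morph _ chiM chi1). Qed.

Lemma chiN1 : chi (-1 : F) = (-1) ^+ h.
Proof.
apply: chi_uniq; last by rewrite rmorphXn /= mulrN1z.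
by rewrite -signr_odd; case: odd; [constructor 3 | constructor 2].
Qed.

Lemma chi_eq1 x : (chi x == 1) = (x ^+ h == 1).
Proof.
rewrite /chi; have [->|x0] := eqVneq x 0; last by case: ifP.
by rewrite expr0n (gtn_eqF half_gt0) [RHS]eq_sym oner_eq0.
Qed.

Lemma chi_eqN1 x : (chi x == -1) = (x ^+ h == -1).
Proof.
have [->|x0] := eqVneq x 0.
  by rewrite chi0 expr0n (gtn_eqF half_gt0) [RHS]eq_sym oppr_eq0 oner_eq0.
rewrite /chi (negPf x0).
by case: (expf_half x0) => ->; rewrite ?(negPf neg1_neq1) ?eqxx // [RHS]eq_sym
  (negPf neg1_neq1).
Qed.

(** A square root [c] in an algebraic closure satisfies [c ^+ #|F| = c] because [x ^+ h = 1], and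
    the roots of ['X^#|F| - 'X] are the elements of [F]. *)
Lemma chi_exists_sqrt x : chi x = 1 -> exists2 y, y != 0 & x = y ^+ 2.
Proof.
move=> /eqP; rewrite chi_eq1 => /eqP xh.
have [K [f _]] := countable_algebraic_closure F.
have [c cE] := @solve_monicpoly K 2 (fun i => if i == 0%N then f x else 0) isT.
have {}cE : c ^+ 2 = f x.
  by rewrite cE !big_ord_recl big_ord0 /= mul0r !addr0 expr0 mulr1.
have : root (map_poly f ('X^#|F| - 'X)) c.
  rewrite rmorphB /= map_polyXn map_polyX rootE !hornerE.
  by rewrite card_half exprS -muln2 mulnC exprM cE -rmorphXn xh rmorph1 mulr1 subrr.
rewrite finField_genPoly rmorph_prod /= rootE horner_prod prodf_seq_eq0.
case/hasP=> y _ /=; rewrite map_polyXsubC hornerXsubC subr_eq0 => /eqP cy.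
exists y; last by apply: (fmorph_inj f); rewrite rmorphXn /= -cy cE.
apply/eqP=> y0; move: xh; rewrite (_ : x = 0).
  by rewrite expr0n (gtn_eqF half_gt0) => /eqP; rewrite eq_sym oner_eq0.
by apply: (fmorph_inj f); rewrite -cE cy y0 rmorph0 expr0n.
Qed.

Lemma chi_sqrtP x : reflect (exists2 y, y != 0 & x = y ^+ 2) (chi x == 1).
Proof.
apply: (iffP eqP) => [/chi_exists_sqrt // | [y y0 ->]]; exact: chi_sqr.
Qed.

Lemma card_chi_leq (e : F) : (#|[set x : F | x ^+ h == e]| <= h)%N.
Proof.
rewrite -ltnS -(@size_XnsubC _ h e half_gt0) cardE; apply: max_poly_roots.
- by rewrite -size_poly_eq0 size_XnsubC // half_gt0.
- by apply/allP=> x; rewrite mem_enum inE rootE !hornerE subr_eq0.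
- exact: enum_uniq.
Qed.

(** The equations [x ^+ h = 1] and [x ^+ h = -1] have at most [h] roots each, and together they
    account for all [2h] nonzero elements. *)
Lemma card_chi (e : F) : e ^+ 2 = 1 -> #|[set x : F | x ^+ h == e]| = h.
Proof.
move=> /eqP; rewrite sqrf_eq1 => e1.
set A := [set x : F | x ^+ h == 1]; set B := [set x : F | x ^+ h == -1].
have : (#|A| + #|B| = h.*2)%N.
  rewrite -cardsUI (_ : A :&: B = set0) ?cards0 ?addn0; last first.
    apply/setP=> x; rewrite !inE; case: eqP => // ->.
    by rewrite eq_sym (negPf neg1_neq1).
  have -> : A :|: B = [set~ 0].
    apply/setP=> x; rewrite !inE -sqrf_eq1.
    have [->|x0] := eqVneq x 0; last by rewrite expf_double_half ?eqxx.
    by rewrite -exprM expr0n muln_eq0 /= orbF -[_ == 0%N]negbK -lt0n half_gt0 eq_sym oner_eq0.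
  by rewrite cardsC1 {1}card_half.
have := card_chi_leq 1; have := card_chi_leq (-1); rewrite -/A -/B => hB hA hAB.
by case/orP: e1 => /eqP ->; rewrite -/A -/B; lia.
Qed.

Lemma prod_XsubC_half (e : F) : e ^+ 2 = 1 ->
  \prod_(x | x ^+ h == e) ('X - x%:P) = 'X^h - e%:P :> {poly F}.
Proof.
move=> e1; set A := [set x : F | x ^+ h == e].
have -> : 'X^h - e%:P = lead_coef ('X^h - e%:P) *: \prod_(x <- enum A) ('X - x%:P).
  apply: all_roots_prod_XsubC; last by rewrite uniq_rootsE enum_uniq.
  - by rewrite size_XnsubC ?half_gt0 // -cardE card_chi.
  - by apply/allP=> x; rewrite mem_enum inE rootE !hornerE subr_eq0.
rewrite (monicP (monicXnsubC e half_gt0)) scale1r big_enum /=.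
by apply: eq_bigl => x; rewrite inE.
Qed.

(** The point [z] may lie in an extension of [F], as the golden ratio does when 5 is not a
    square. *)
Lemma prod_sub_half (K : comNzRingType) (f : {rmorphism F -> K}) (e : F) (z : K) :
  e ^+ 2 = 1 -> \prod_(x | x ^+ h == e) (z - f x) = z ^+ h - f e.
Proof.
move=> /prod_XsubC_half /(congr1 (fun P => (map_poly f P).[z])).
rewrite rmorph_prod rmorphB /= map_polyXn map_polyC horner_prod !hornerE => <-.
by apply: eq_bigr => x _; rewrite map_polyXsubC hornerXsubC.
Qed.

Lemma prod_sub_chi1 (K : comNzRingType) (f : {rmorphism F -> K}) (z : K) :
  \prod_(x | chi x == 1) (z - f x) = z ^+ h - 1.
Proof.
rewrite -[in RHS](rmorph1 f) -(@prod_sub_half K f 1 z) ?expr1n //.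
by apply: eq_bigl => x; rewrite chi_eq1.
Qed.

Lemma prod_sub_chiN1 (K : comNzRingType) (f : {rmorphism F -> K}) (z : K) :
  \prod_(x | chi x == -1) (z - f x) = z ^+ h + 1.
Proof.
rewrite -[in RHS](opprK 1) -(rmorphN1 f) -(@prod_sub_half K f (-1) z) ?sqrrN ?expr1n //.
by apply: eq_bigl => x; rewrite chi_eqN1.
Qed.

Lemma card_chiN1 : #|[set x : F | chi x == -1]| = h.
Proof.
rewrite -(@card_chi (-1)) ?sqrrN ?expr1n //; apply: eq_card => x.
by rewrite !inE chi_eqN1.
Qed.

(** Multiplication by a nonresidue permutes [F] and negates every term. *)
Lemma sum_chi : \sum_(x : F) chi x = 0.
Proof.
have /card_gt0P[c] : (0 < #|[set x : F | (chi x == -1)%R]|)%N.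
  by rewrite card_chiN1 half_gt0.
rewrite inE => /eqP cN; have c0 : c != 0 by rewrite -chi_eq0 cN.
have : \sum_(x : F) chi x = - \sum_(x : F) chi x.
  rewrite {1}(reindex_inj (mulfI c0)) -sumrN /=.
  by apply: eq_bigr => x _; rewrite chiM cN mulN1r.
by lia.
Qed.

Lemma sum_chi_affine a b : a != 0 -> \sum_x chi (a * x + b) = 0.
Proof.
move=> a0; rewrite -[RHS]sum_chi [RHS](reindex_inj (h := fun x => a * x + b)) //=.
by move=> x y /addIr /(mulfI a0).
Qed.

(* [chi((x-a)(x-b)) = chi(1 + (b-a)/(x-b))] for [x <> b]. *)
Lemma sum_chi2 a b : a != b -> \sum_x chi ((x - a) * (x - b)) = -1.
Proof.
move=> ab; rewrite (bigD1 b) //= subrr mulr0 chi0 add0r.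
have c0 : b - a != 0 by rewrite subr_eq0 eq_sym.
transitivity (\sum_(y : F | y != 1) chi y).
  rewrite [RHS](reindex_onto (fun x => 1 + (b - a) / (x - b))
                    (fun y => b + (b - a) / (y - 1))) /=; last first.
    move=> y y1; have y10 : y - 1 != 0 by rewrite subr_eq0.
    by rewrite [b + _ / _]addrC addrK invf_div mulrC divfK // addrC subrK.
  apply: eq_big => [x | x xb].
    have [->|xb] := eqVneq x b; first by rewrite subrr invr0 mulr0 addr0 eqxx.
    have xb0 : x - b != 0 by rewrite subr_eq0.
    have -> : (1 + (b - a) / (x - b) != 1).
      by rewrite -subr_eq0 addrC addKr mulf_eq0 invr_eq0 negb_or c0.
    by rewrite addrAC subrr add0r invf_div mulrC divfK ?xb0 // addrC subrK eqxx.
  have xb0 : x - b != 0 by rewrite subr_eq0.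
  have -> : (x - a) * (x - b) = (x - b) ^+ 2 * (1 + (b - a) / (x - b)).
    by field.
  by rewrite chiM chi_sqr // mul1r.
have := sum_chi; rewrite (bigD1 1) //= chi1 => /eqP.
by rewrite addrC addr_eq0 => /eqP.
Qed.

(** * Counting sign patterns *)

Definition pattern (s1 s2 s3 : int) (e x : F) :=
  [&& chi x == s1, chi (x - 1) == s2 & chi (x - e) == s3].

(* The last three terms are the contributions of [x = 0], [1] and [e] to the sum of
   [(1 + s1 chi x)(1 + s2 chi (x-1))(1 + s3 chi (x-e))]. *)
Lemma card_pattern (s1 s2 s3 : int) (e : F) :
  sgn_val s1 -> s1 != 0 -> sgn_val s2 -> s2 != 0 -> sgn_val s3 -> s3 != 0 ->
  e != 0 -> e != 1 ->
  (#|[set x | pattern s1 s2 s3 e x]| * 8)%:Z =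
    #|F|%:Z - s1 * s2 - s1 * s3 - s2 * s3
    + s1 * s2 * s3 * \sum_x chi (x * (x - 1) * (x - e))
    - (1 + s2 * chi (-1 : F)) * (1 + s3 * chi (- e))
    - (1 + s1) * (1 + s3 * chi (1 - e))
    - (1 + s1 * chi e) * (1 + s2 * chi (e - 1)).
Proof.
move=> H1 n1 H2 n2 H3 n3 e0 e1.
pose w x := (1 + s1 * chi x) * (1 + s2 * chi (x - 1)) * (1 + s3 * chi (x - e)).
have Etot : \sum_(x : F) w x = #|F|%:Z - s1 * s2 - s1 * s3 - s2 * s3
    + s1 * s2 * s3 * \sum_x chi (x * (x - 1) * (x - e)).
  have -> : \sum_(x : F) w x = \sum_x (1 + s1 * chi (1 * x + 0) + s2 * chi (1 * x + (-1))
      + s3 * chi (1 * x + (-e))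
      + s1 * s2 * chi ((x - 0) * (x - 1)) + s1 * s3 * chi ((x - 0) * (x - e))
      + s2 * s3 * chi ((x - 1) * (x - e))
      + s1 * s2 * s3 * chi (x * (x - 1) * (x - e))).
    by apply: eq_bigr => x _; rewrite /w !chiM !mul1r !addr0 !subr0; ring.
  rewrite !big_split /= -!mulr_sumr !sum_chi_affine ?oner_eq0 //.
  rewrite !sum_chi2 1?eq_sym ?oner_eq0 // sumr_const.
  by rewrite -mulr_natr mul1r natz; ring.
(* Away from [0], [1] and [e] each factor of [w x] is 0 or 2. *)
have Epat x : x != 0 -> x != 1 -> x != e ->
    w x = if pattern s1 s2 s3 e x then 8 else 0.
  move=> x0 x1 xe; rewrite /w /pattern.
  move: H1 n1 H2 n2 H3 n3.
  have x10 : x - 1 != 0 by rewrite subr_eq0.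
  have xe0 : x - e != 0 by rewrite subr_eq0.
  case: (chi_pm x0) => ->; case: (chi_pm x10) => ->; case: (chi_pm xe0) => ->;
  by case=> -> // _ [] -> // _ [] -> // _.
have Ebnd x : [|| x == 0, x == 1 | x == e] -> pattern s1 s2 s3 e x = false.
  move=> /or3P[] /eqP ->; rewrite /pattern ?subrr chi0 eq_sym.
  - by rewrite (negPf n1).
  - by rewrite [0 == s2]eq_sym (negPf n2) andbF.
  - by rewrite [0 == s3]eq_sym (negPf n3) !andbF.
have : \sum_(x : F) w x = w 0 + w 1 + w e
    + \sum_(x | pattern s1 s2 s3 e x) 8.
  rewrite (bigD1 0) //= (bigD1 1) ?oner_eq0 //= (bigD1 e) ?e0 //= !addrA.
  congr (_ + _); rewrite big_mkcond [RHS]big_mkcond; apply: eq_bigr => x _ /=.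
  have [x0|x0] := eqVneq x 0; first by rewrite Ebnd ?x0 ?eqxx.
  have [x1|x1] := eqVneq x 1; first by rewrite Ebnd ?x1 ?eqxx ?orbT.
  have [xe|xe] := eqVneq x e; first by rewrite Ebnd ?xe ?eqxx ?orbT.
  by rewrite /= Epat.
rewrite Etot sumr_const -[8 *+ _]mulr_natr [#|_|%:R]natz => E.
have -> : #|[set x | pattern s1 s2 s3 e x]| 
    = #|fun x => [&& chi x == s1, chi (x - 1) == s2 & chi (x - e) == s3]|.
  by apply: eq_card => x; rewrite inE.
rewrite PoszM mulrC -(addKr (w 0 + w 1 + w e) (8 * _)) -E.
rewrite /w !subrr !chi0 !sub0r chi1; ring.
Qed.

End QuadraticCharacter.

(** * Half systems modulo a prime *)

(** The value 1 at zero reproduces the omission of the factors divisible by [p]. *)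
Definition chi_nz (F : finFieldType) (x : F) : int := if x == 0 then 1 else chi x.

Definition pos_half (p : nat) : pred 'F_p := fun x => (0 < x <= p./2)%N.
Arguments pos_half : simpl never.

Definition half_sign (p : nat) (x : 'F_p) : int := if pos_half x then 1 else -1.

Definition half_abs (p : nat) (x : 'F_p) : 'F_p := if pos_half x then x else - x.

Section PrimeField.

Variable p : nat.
Hypotheses (p_pr : prime p) (p_gt2 : (2 < p)%N).

Local Notation F := 'F_p.
Implicit Types x y t r j k : F.

Lemma odd_p : odd p.
Proof. by case: (even_prime p_pr) p_gt2 => // ->. Qed.

Lemma p_eq : p = (p./2).*2.+1.
Proof. by rewrite -[LHS]odd_double_half odd_p. Qed.

Lemma odd_card_Fp : odd #|F|.
Proof. by rewrite card_Fp // odd_p. Qed.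
Local Notation oF := odd_card_Fp.

Lemma ltn_Fp x : (x < p)%N.
Proof. by rewrite -{2}(Fp_cast p_pr) ltn_ord. Qed.

Lemma natr_Fp x : ((x : nat)%:R : F) = x.
Proof. exact: natr_Zp. Qed.

Lemma val_Fp_lt n : (n < p)%N -> ((n%:R : F) : nat) = n.
Proof. by move=> np; rewrite val_Fp_nat // modn_small. Qed.

Lemma val_Fp_gt0 x : (0 < x)%N = (x != 0).
Proof. by rewrite lt0n. Qed.

Lemma val_FpD x y : ((x + y)%R : nat) = ((x + y) %% p)%N.
Proof. by rewrite -{1}(natr_Fp x) -{1}(natr_Fp y) -natrD val_Fp_nat. Qed.

Lemma val_FpN x : x != 0 -> ((- x)%R : nat) = (p - x)%N.
Proof.
move=> x0; have xp := ltn_Fp x; rewrite -(@val_Fp_lt (p - x)); last first.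
  by rewrite -val_Fp_gt0 in x0; lia.
congr (nat_of_ord _); rewrite natrB; last exact: ltnW.
by rewrite pchar_Fp_0 // natr_Fp sub0r.
Qed.

Lemma intr_Fp_eq0 (z : int) : ((z%:~R : F) == 0) = (p %| z)%Z.
Proof.
case: z => k; rewrite ?NegzE ?rmorphN /= ?oppr_eq0 ?dvdzN //=.
  by rewrite -[_%:~R]/(k%:R) -(dvdn_pcharf (pchar_Fp p_pr)).
by rewrite -[_%:~R]/(k.+1%:R) -(dvdn_pcharf (pchar_Fp p_pr)).
Qed.

Lemma legendre_chi (a : int) : legendre p a = chi (a%:~R : F).
Proof.
rewrite /legendre -intr_Fp_eq0; case: (eqVneq (a%:~R : F) 0) => [->|a0].
  by rewrite chi0.
have -> : [exists x : 'I_p, (x%:Z ^+ 2 == a %[mod p])%Z] = (chi (a%:~R : F) == 1).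
  apply/existsP/(chi_sqrtP oF) => [[x] | [y _ ya]].
    rewrite eqz_mod_dvd -intr_Fp_eq0 rmorphB rmorphXn /= subr_eq0 => /eqP e.
    exists (x%:Z%:~R) => //; apply: contraNneq a0 => x0.
    by rewrite -e x0 expr0n.
  exists (Ordinal (ltn_Fp y)); rewrite eqz_mod_dvd -intr_Fp_eq0.
  by rewrite rmorphB rmorphXn /= -[_%:~R in X in X - _]/((y : nat)%:R) natr_Fp ya subrr.
by case: (chi_pm a0) => ->.
Qed.

Lemma big_Fp (R : Type) (idx : R) (op : Monoid.law idx) (P : pred nat) (g : nat -> R) :
  \big[op/idx]_(0 <= i < p | P i) g i = \big[op/idx]_(x : F | P x) g x.
Proof. by rewrite -{1}(Fp_cast p_pr) big_mkord. Qed.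

Lemma F01E n :
  F01 p n = \sum_(y : F) chi (y * (y + 1) * (y + ratr n)).
Proof.
pose g (y : nat) := chi (y%:R * (y%:R + 1) * (y%:R + ratr n) : F).
have -> : \sum_(y : F) chi (y * (y + 1) * (y + ratr n)) = \sum_(y : F) g y.
  by apply: eq_bigr => y _; rewrite /g natr_Fp.
rewrite -(big_Fp _ xpredT g) /F01 /F01int.
(* The summand at [y = p] is moved to [y = 0], so that the sum runs over all of ['F_p]. *)
rewrite big_nat_recr ?prime_gt0 //= [RHS]big_ltn ?prime_gt0 // addrC.
have gE w : legendre p (w%:Z * (w%:Z + 1) * (w%:Z + ((ratr n : F) : nat)%:Z)) = g w.
  rewrite legendre_chi !rmorphM !rmorphD /= rmorph1.
  by rewrite /g -[X in _ = chi (_ * (_ + X))]natr_Fp.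
congr (_ + _); first by rewrite gE /g pchar_Fp_0.
by apply: eq_bigr => w _; rewrite gE.
Qed.

Lemma pos_half0 : pos_half (0 : F) = false. Proof. by []. Qed.

Lemma half_abs0 : half_abs (0 : F) = 0.
Proof. by rewrite /half_abs pos_half0 oppr0. Qed.

Lemma pos_half_neq0 x : pos_half x -> x != 0.
Proof. by rewrite /pos_half val_Fp_gt0 => /andP[]. Qed.

Lemma pos_halfN x : x != 0 -> pos_half (- x) = ~~ pos_half x.
Proof.
move=> x0; rewrite /pos_half val_FpN //.
have := ltn_Fp x; have := p_eq; rewrite -val_Fp_gt0 in x0; lia.
Qed.

Lemma half_abs_pos x : x != 0 -> pos_half (half_abs x).
Proof. by move=> x0; rewrite /half_abs; case: ifP => // nx; rewrite pos_halfN ?nx. Qed.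

Lemma half_abs_id x : pos_half x -> half_abs x = x.
Proof. by rewrite /half_abs => ->. Qed.

Lemma half_absE x : half_abs x = (half_sign x)%:~R * x.
Proof. by rewrite /half_abs /half_sign; case: ifP; rewrite ?mul1r ?mulN1r. Qed.

Lemma half_absN x : half_abs (- x) = half_abs x.
Proof.
have [->|x0] := eqVneq x 0; first by rewrite oppr0.
by rewrite /half_abs pos_halfN //; case: pos_half; rewrite ?opprK.
Qed.

Lemma half_abs_eq x y : half_abs x = y -> x = y \/ x = - y.
Proof. by rewrite /half_abs; case: ifP => _ <-; rewrite ?opprK; [left | right]. Qed.

Lemma half_abs_sqr x : half_abs x ^+ 2 = x ^+ 2.
Proof. by rewrite /half_abs; case: ifP => _; rewrite ?sqrrN. Qed.

Lemma half_abs_M x y : half_abs (x * half_abs y) = half_abs (x * y).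
Proof. by rewrite {2}/half_abs; case: ifP => _ //; rewrite mulrN half_absN. Qed.

Section Big.
Variables (R : Type) (idx : R) (op : Monoid.com_law idx).

(** The map [j -> |t j|] permutes the lower half, with inverse [j -> |j / t|]. *)
Lemma big_half_abs (g : F -> R) t : t != 0 ->
  \big[op/idx]_(j | pos_half j) g (half_abs (t * j)) = \big[op/idx]_(j | pos_half j) g j.
Proof.
move=> t0; rewrite [RHS](reindex_onto (fun j => half_abs (t * j))
                                     (fun j => half_abs (t^-1 * j))) /=; last first.
  by move=> j jp; rewrite half_abs_M mulVKf // half_abs_id.
apply: eq_bigl => j; have [->|j0] := eqVneq j 0.
  by rewrite mulr0 half_abs0 pos_half0.
rewrite half_abs_pos ?mulf_neq0 //= half_abs_M mulKf //.
apply/idP/eqP => [/half_abs_id // | <-]; exact: half_abs_pos.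
Qed.

Lemma big_neq0_half (g : F -> R) :
  \big[op/idx]_(x | x != 0) g x = \big[op/idx]_(x | pos_half x) op (g x) (g (- x)).
Proof.
rewrite big_split (bigID (@pos_half p)) /=; congr (op _ _).
  by apply: eq_bigl => x; case: (boolP (pos_half x)) => [/pos_half_neq0 ->|]; rewrite ?andbF.
rewrite (reindex_inj (@oppr_inj F)) /=; apply: eq_bigl => x.
rewrite oppr_eq0; have [->|x0] := eqVneq x 0; first by rewrite /pos_half.
by rewrite pos_halfN // negbK.
Qed.

(** Every nonzero square has exactly one root in the lower half. *)
Lemma big_half_sqr (g : F -> R) :
  \big[op/idx]_(x | pos_half x) g (x ^+ 2) = \big[op/idx]_(x | chi x == 1) g x.
Proof.
pose sq (x : F) := odflt 0 [pick y : F | pos_half y & y ^+ 2 == x].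
rewrite [RHS](reindex_onto (fun x => x ^+ 2) sq) /=; last first.
  move=> x /(chi_sqrtP oF)[y y0 ->]; rewrite /sq; case: pickP => [z /andP[_ /eqP] //|].
  by move/(_ (half_abs y)); rewrite half_abs_pos // half_abs_sqr eqxx.
apply: eq_bigl => x; rewrite /sq; case: (boolP (pos_half x)) => [xp|xn].
  rewrite (chi_sqr oF) ?pos_half_neq0 //=; case: pickP => [z /= /andP[zp]|].
    rewrite eqf_sqr => /orP[/eqP-> | /eqP zx]; first by rewrite eqxx.
    by move: zp; rewrite zx pos_halfN ?pos_half_neq0 // xp.
  by move/(_ x); rewrite xp eqxx.
case: pickP => [z /= /andP[zp _]|_].
  by apply/esym/andP=> -[_ /eqP zx]; rewrite -zx zp in xn.
by apply/esym/andP=> -[xx /eqP x0]; move: xx; rewrite -x0 expr0n chi0.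
Qed.

End Big.

Lemma card_pos_half : #|[pred x : F | pos_half x]| = p./2.
Proof.
have : (\sum_(x : F | (x != 0)%R) 1 = \sum_(x : F | pos_half x) (1 + 1))%N.
  by rewrite big_neq0_half.
rewrite !sum_nat_const cardC1 card_Fp // muln1 {1}p_eq /= => e.
by apply: double_inj; rewrite e addn1 muln2; congr double; apply: eq_card.
Qed.

(** Both sides are signs and may be compared in [F]. Since [j -> |t j|] permutes the lower half, the
    product of the signs times the product of all [j] is the product of all [t j]. *)
Lemma gauss_lemma t : t != 0 -> \prod_(j : F | pos_half j) half_sign (t * j) = chi t.
Proof.
move=> t0; apply: (sgn_val_inj oF).
- elim/big_ind: _ => [||i _]; [by constructor 2 | exact: sgn_valM |].
  by rewrite /half_sign; case: ifP; [constructor 2 | constructor 3].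
- exact: chi_sgn.
rewrite chiE ?oF // card_Fp //.
have P0 : \prod_(j : F | pos_half j) j != 0.
  by rewrite prodf_seq_neq0; apply/allP=> j _; apply/implyP; apply: pos_half_neq0.
apply: (mulIf P0); rewrite -{1}(big_half_abs _ id t0) rmorph_prod -big_split /=.
transitivity (\prod_(j : F | pos_half j) (t * j)).
  apply: eq_bigr => j _; rewrite half_absE mulrA -rmorphM /half_sign.
  by case: ifP; rewrite mul1r.
by rewrite big_split /= prodr_const card_pos_half.
Qed.

(** Doubling an element of the upper half subtracts the odd number [p] once, which makes the
    representative of [2 x] odd. *)
Lemma half_sign_odd x : x != 0 -> half_sign x = (-1) ^+ odd (2 * x)%R.
Proof.
move=> x0; rewrite -val_Fp_gt0 in x0.
rewrite mulr_natl mulr2n val_FpD /half_sign /pos_half x0 /=.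
have xp := ltn_Fp x; have pE := p_eq; case: leqP => xh.
  rewrite modn_small; last by lia.
  by rewrite addnn odd_double.
have -> : (x + x = (x + x - p) + p)%N by lia.
rewrite modnDr modn_small; last by lia.
by have -> : odd (x + x - p) by lia.
Qed.

(** By [half_sign_odd] the signs are the parities of the representatives of [j - k] and [j + k]. The
    sum stays below [p], while the difference wraps around, and so changes parity, exactly when
    [j < k]. *)
Lemma half_sign_subD j k : pos_half j -> pos_half k -> j != k ->
  half_sign ((j - k) / 2) * half_sign ((j + k) / 2) = if (k < j)%N then 1 else -1.
Proof.
have F2 : (2 : F) != 0 by apply: two_neq0 oF.
move=> jp kp jk; have k0 := pos_half_neq0 kp; have j0 := pos_half_neq0 jp.
have jkN : j - k != 0 by rewrite subr_eq0.
have jkD : j + k != 0.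
  by apply: contraTneq jp => /eqP; rewrite addr_eq0 => /eqP ->; rewrite pos_halfN ?kp.
have nz x : x != 0 -> x / 2 != 0 by move=> ?; rewrite mulf_neq0 ?invr_eq0.
rewrite !half_sign_odd ?nz // !(mulrC 2) !divfK // val_FpD val_FpN // val_FpD.
move: jp kp => /andP[j0' jh] /andP[k0' kh]; have pE := p_eq.
have jkv : (j : nat) <> k by move=> /val_inj /eqP; rewrite (negPf jk).
rewrite [((j + k) %% p)%N]modn_small; last by lia.
case: ltnP => kj.
  have -> : (j + (p - k) = (j - k) + p)%N by lia.
  rewrite modnDr modn_small; last by lia.
  by rewrite -signr_addb -oddD (_ : odd _ = false) //; lia.
rewrite modn_small; last by lia.
by rewrite -signr_addb -oddD (_ : odd _ = true) //; lia.
Qed.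

(* Gauss's lemma for [(1-r)/2] and [(1+r)/2]: the two signs attached to [j] multiply to
   the sign of [j - |rj|], because [x/2] is in the lower half iff [x] is even. *)
Lemma prod_sign_half_abs r : r != 0 -> r != 1 -> r != -1 ->
  \prod_(j : F | pos_half j) (if (half_abs (r * j)%R < j)%N then 1 else -1) = chi (1 - r ^+ 2).
Proof.
move=> r0 r1 rN1; have F2 : (2 : F) != 0 by apply: two_neq0 oF.
have a0 : (1 - r) / 2 != 0 by rewrite mulf_neq0 ?invr_eq0 // subr_eq0 eq_sym.
have b0 : (1 + r) / 2 != 0.
  by rewrite mulf_neq0 ?invr_eq0 // addrC addr_eq0.
have -> : chi (1 - r ^+ 2) = chi ((1 - r) / 2) * chi ((1 + r) / 2).
  rewrite -(chiM oF) (_ : (1 - r) / 2 * ((1 + r) / 2) = (1 - r ^+ 2) * (2^-1) ^+ 2).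
    by rewrite (chiM oF) (chi_sqr oF) ?mulr1 // invr_eq0.
  by field.
rewrite -!gauss_lemma // -big_split /=; apply: eq_bigr => j jp.
have j0 := pos_half_neq0 jp.
have -> : (1 - r) / 2 * j = (j - r * j) / 2 by field.
have -> : (1 + r) / 2 * j = (j + r * j) / 2 by field.
have kp : pos_half (half_abs (r * j)) by rewrite half_abs_pos // mulf_neq0.
have jk : j != half_abs (r * j).
  apply/eqP=> /esym /half_abs_eq[]; last rewrite -mulN1r; last by
    move/(mulIf j0)/eqP; rewrite (negPf rN1).
  by rewrite -[in RHS](mul1r j) => /(mulIf j0)/eqP; rewrite (negPf r1).
rewrite -half_sign_subD //.
(* If [r j = - |r j|], the two factors merely change places. *)
by case: (half_abs_eq (erefl (half_abs (r * j)))) => {3 4}->; rewrite ?opprK // mulrC.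
Qed.

End PrimeField.

(** * Products over pairs *)

(** The new variable [t] is the ratio [y / x]: this groups the pairs by their ratio. *)
Lemma prod_scale (F : finFieldType) (P : pred F) (G : F -> int) (x : F) :
  x != 0 -> ~~ P 0 ->
  \prod_(y | P y) G y = \prod_(t | t != 0) (if P (t * x) then G (t * x) else 1).
Proof.
move=> x0 /negPf P0.
by rewrite [LHS]big_mkcond (reindex_inj (mulIf x0)) (bigD1 0) //= mul0r P0 mul1r.
Qed.

Lemma prod_triangle_shear (p : nat) :
  prod_triangle (1, 1, -1) p = prod_triangle (1, -3, 1) p.
Proof.
(* Substitute [i] by [j - i]. *)
rewrite /prod_triangle [LHS]/= [RHS]/=; apply: eq_bigr => j _; rewrite big_nat_rev.
have E (i : nat) : (1 <= i < j)%N ->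
    qform (1, 1, -1) (1 + j - i.+1) j = qform (1, -3, 1) i j.
  move=> /andP[i0 ij]; have -> : (1 + j - i.+1 = j - i)%N by lia.
  by rewrite /qform -subzn; [ring | exact: ltnW].
rewrite /qform /= in E; rewrite big_nat_cond [RHS]big_nat_cond.
apply: eq_big => [i|i /andP[ij _]]; last by rewrite E.
by case: (boolP (1 <= i < j)%N) => [ij|//]; rewrite E.
Qed.

Section HalfSystemProducts.

Variable p : nat.
Hypotheses (p_pr : prime p) (p_gt2 : (2 < p)%N).

Local Notation F := 'F_p.
Implicit Types x y t r j k i a b c : F.
Local Notation oF := (odd_card_Fp p_pr p_gt2).

Lemma chi_nz_pm x : chi_nz x = 1 \/ chi_nz x = -1.
Proof. by rewrite /chi_nz; case: (eqVneq x 0) => [_|/chi_pm //]; left. Qed.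

Lemma chi_nz_sqrM x y : x != 0 -> chi_nz (x ^+ 2 * y) = chi_nz y.
Proof.
move=> x0; rewrite /chi_nz mulf_eq0 expf_eq0 (negPf x0) /=.
by rewrite (chiM oF) (chi_sqr oF) // mul1r.
Qed.

Lemma chi_nz_nat (z : int) :
  chi_nz (z%:~R : F) = if ~~ (p %| z)%Z then legendre p z else 1.
Proof. by rewrite /chi_nz intr_Fp_eq0 // legendre_chi //; case: (p %| z)%Z. Qed.

Lemma qform_Fp (f : int * int * int) i j :
  (qform f i j)%:~R = f.1.1%:~R * i ^+ 2 + f.1.2%:~R * (i * j) + f.2%:~R * j ^+ 2 :> F.
Proof.
case: f => [[a b] c] /=; rewrite !rmorphD !rmorphM /=.
by rewrite -![(Posz _)%:~R]/(_%:R) !natr_Fp.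
Qed.

Lemma prod_triangle_Fp (f : int * int * int) :
  prod_triangle f p = \prod_(j : F | pos_half j) \prod_(i : F | pos_half i && (i < j)%N)
    chi_nz (f.1.1%:~R * i ^+ 2 + f.1.2%:~R * (i * j) + f.2%:~R * j ^+ 2).
Proof.
rewrite /prod_triangle /= (big_nat_widenl _ 0) // (big_Fp p_pr).
have pE := p_eq p_pr p_gt2.
apply: eq_big => [j | j /andP[jh j0]]; first by rewrite /pos_half; lia.
rewrite (big_nat_widenl _ 0) // (@big_nat_widen _ _ _ _ j p); last exact: ltnW (ltn_Fp p_pr j).
rewrite big_mkcondr /= big_mkcondr /= big_mkcond /=.
rewrite (big_Fp p_pr _ xpredT) [RHS]big_mkcond /=; apply: eq_bigr => i _.
rewrite -qform_Fp chi_nz_nat.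
have -> : (pos_half i && (i < j)%N) = (1 <= i)%N && (i < j)%N.
  rewrite /pos_half; lia.
by case: (1 <= i)%N; case: (i < j)%N; case: (p %| _)%Z.
Qed.

Lemma prod_square_Fp (f : int * int * int) :
  prod_square f p = \prod_(j : F | pos_half j) \prod_(i : F | pos_half i)
    chi_nz (f.1.1%:~R * i ^+ 2 + f.1.2%:~R * (i * j) + f.2%:~R * j ^+ 2).
Proof.
have pE := p_eq p_pr p_gt2.
have ph : (p.-1)./2 = p./2 by lia.
have hp : ((p./2).+1 <= p)%N by lia.
rewrite exchange_big /prod_square /= ph (big_nat_widenl _ 0) //.
rewrite (@big_nat_widen _ _ _ _ _ p) // (big_Fp p_pr).
apply: eq_big => [i | i _]; first by rewrite /pos_half ltnS.
rewrite (big_nat_widenl _ 0) // (@big_nat_widen _ _ _ _ _ p) //.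
rewrite big_mkcond /= (big_Fp p_pr _ xpredT) [RHS]big_mkcond /=; apply: eq_bigr => j _.
rewrite -qform_Fp chi_nz_nat /pos_half ltnS.
by case: (1 <= j)%N; case: (j <= _)%N; case: (p %| _)%Z.
Qed.

(** The left side is [w] to the number of [j] with [P j]. The signs on the right multiply to -1 to
    the number of the other [j], and [chi (-1)], which is -1 to the size of the half system,
    converts this into the parity of the first number. *)
Lemma prod_if_sign (P : pred F) (w : int) : w = 1 \/ w = -1 ->
  \prod_(j : F | pos_half j) (if P j then w else 1) =
  if chi (-1 : F) * \prod_(j : F | pos_half j) (if P j then 1 else -1 : int) == -1
  then w else 1.
Proof.
case=> ->; first by rewrite if_same big1 // => j _; rewrite if_same.
have -> : \prod_(j : F | pos_half j) (if P j then -1 else 1 : int)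
    = chi (-1 : F) * \prod_(j : F | pos_half j) (if P j then 1 else -1 : int).
  rewrite (chiN1 oF) card_Fp // -(card_pos_half p_pr p_gt2) -prodr_const -big_split /=.
  by apply: eq_bigr => j _; case: (P j).
have : sgn_val (\prod_(j : F | pos_half j) (if P j then 1 else -1 : int)).
  elim/big_ind: _ => [||i _]; [by constructor 2 | exact: sgn_valM |].
  by case: (P i); [constructor 2 | constructor 3].
have : \prod_(j : F | pos_half j) (if P j then 1 else -1 : int) != 0.
  by rewrite prodf_seq_neq0; apply/allP=> j _; case: (P j); apply/implyP.
have N0 : (-1 : F) != 0 by rewrite oppr_eq0 oner_eq0.
by move=> P0 [] PE; rewrite PE in P0 *; case: (chi_pm N0) => ->.
Qed.

(** With [i = |r j|] the factor depends on [r ^+ 2] alone, and by [prod_sign_half_abs] it occurs an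
    odd number of times exactly when [chi (r ^+ 2 - 1) = -1]. Then [x = r ^+ 2]. *)
Lemma triangle_even a c :
  \prod_(j : F | pos_half j) \prod_(i : F | pos_half i && (i < j)%N)
    chi_nz (a * i ^+ 2 + c * j ^+ 2)
  = \prod_(x : F | (chi x == 1) && (chi (x - 1) == -1)) chi_nz (a * x + c).
Proof.
transitivity (\prod_(j : F | pos_half j) \prod_(r : F | pos_half r)
    (if (half_abs (r * j)%R < j)%N then chi_nz (a * r ^+ 2 + c) else 1)).
  apply: eq_bigr => j /(pos_half_neq0) j0.
  rewrite big_mkcondr /= -(big_half_abs p_pr p_gt2 _
    (fun i => if (i < j)%N then chi_nz (a * i ^+ 2 + c * j ^+ 2) else 1) j0); apply: eq_bigr => r _.
  rewrite half_abs_sqr (mulrC j r) exprMn -(chi_nz_sqrM (a * r ^+ 2 + c) j0).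
  by rewrite mulrDr !(mulrC (j ^+ 2)) mulrA.
rewrite exchange_big /= [RHS]big_mkcondr /=.
rewrite -(big_half_sqr p_pr p_gt2 _
  (fun x : F => if chi (x - 1) == -1 then chi_nz (a * x + c) else 1)).
apply: eq_bigr => r rp; rewrite (prod_if_sign _ (chi_nz_pm _)).
have r0 := pos_half_neq0 rp.
(* For [r = 1] no [j] satisfies [|r j| < j], in accordance with [chi 0 = 0]. *)
have [->|r1] := eqVneq r 1.
  rewrite expr1n subrr chi0 (eq_bigr (fun=> -1)) => [|j jp]; last first.
    by rewrite mul1r half_abs_id // ltnn.
  rewrite prodr_const card_pos_half // -[p in p./2]card_Fp // -(chiN1 oF) chi_sqr1 //.
  by rewrite oppr_eq0 oner_eq0.
have rN1 : r != -1.
  apply: contraTneq rp => ->; rewrite pos_halfN ?oner_eq0 // negbK /pos_half.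
  by rewrite -[1%R : F]/(1%:R) val_Fp_lt ?prime_gt1 //; have := p_eq p_pr p_gt2; lia.
by rewrite prod_sign_half_abs // -(chiM oF) mulN1r opprB.
Qed.

Section Mobius.
Variables (R : Type) (idx : R) (op : Monoid.com_law idx).

Lemma sqr_eq1_pos r : pos_half r -> (r ^+ 2 == 1) = (r == 1).
Proof.
move=> rp; rewrite sqrf_eq1 orbC; case: eqP rp => // ->.
rewrite pos_halfN ?oner_eq0 // /pos_half.
by rewrite -[1%R : F]/(1%:R) val_Fp_lt ?prime_gt1 //; have := p_eq p_pr p_gt2; lia.
Qed.

(* [t = (1+r)/(1-r)] turns inversion of [t] into negation of [r]. *)
Lemma big_mobius (g : F -> R) :
  \big[op/idx]_(t : F | (t != 0) && (t ^+ 2 != 1)) g t =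
  \big[op/idx]_(r : F | pos_half r && (r != 1))
    op (g ((1 + r) / (1 - r))) (g ((1 + r) / (1 - r))^-1).
Proof.
have F2 : (2 : F) != 0 by apply: two_neq0 oF.
have sq x : x ^+ 2 != 1 -> (1 - x != 0) && (1 + x != 0).
  rewrite sqrf_eq1 negb_or => /andP[x1 xN1].
  by rewrite subr_eq0 eq_sym x1 addrC addr_eq0.
rewrite (reindex_onto (fun r => (1 + r) / (1 - r)) (fun t => (t - 1) / (t + 1))) /=;
  last first.
  move=> t /andP[t0 /sq /andP[t1 t2]].
  have t2' : t + 1 != 0 by rewrite addrC.
  have e1 : 1 + (t - 1) / (t + 1) = 2 * t / (t + 1) by field.
  have e2 : 1 - (t - 1) / (t + 1) = 2 / (t + 1) by field.
  by rewrite e1 e2; field; rewrite F2 t2'.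
transitivity (\big[op/idx]_(r : F | (r != 0) && (r ^+ 2 != 1)) g ((1 + r) / (1 - r))).
  (* At [r = 1], by the convention on division by zero, and at [r = -1] the quotient is 0, so
     [t != 0] excludes both. *)
  apply: eq_bigl => r; have [rr|rN] := eqVneq (r ^+ 2) 1.
    rewrite andbF; apply/negbTE; rewrite !negb_and !negbK.
    move/eqP: rr; rewrite sqrf_eq1 => /orP[] /eqP ->.
      by rewrite subrr invr0 mulr0 eqxx.
    by rewrite subrr mul0r eqxx.
  have /andP[r1 r2] := sq _ rN.
  have -> : ((1 + r) / (1 - r) - 1) / ((1 + r) / (1 - r) + 1) = r.
    have -> : (1 + r) / (1 - r) - 1 = 2 * r / (1 - r) by field.
    have -> : (1 + r) / (1 - r) + 1 = 2 / (1 - r) by field.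
    by field; rewrite F2 r1.
  rewrite eqxx mulf_neq0 ?invr_eq0 //= !andbT.
  have -> : (((1 + r) / (1 - r)) ^+ 2 == 1) = (4 * r / (1 - r) ^+ 2 == 0).
    rewrite -subr_eq0; congr (_ == 0); field; exact: r1.
  rewrite mulf_eq0 invr_eq0 expf_eq0 (negPf r1) /= orbF mulf_eq0.
  have -> : (4 : F) = 2 * 2 by ring.
  by rewrite mulf_eq0 (negPf F2).
rewrite big_mkcondr /= (big_neq0_half p_pr p_gt2) [RHS]big_mkcondr /=.
apply: eq_bigr => r rp; rewrite sqrrN sqr_eq1_pos //; case: eqP => _; first by rewrite Monoid.mul1m.
by rewrite opprK invf_div.
Qed.

End Mobius.

Lemma prod_if_pos_half (w : int) t : t != 0 -> w = 1 \/ w = -1 ->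
  \prod_(j : F | pos_half j) (if pos_half (t * j) then w else 1) =
  if chi (- t) == -1 then w else 1.
Proof.
move=> t0 w1; rewrite (prod_if_sign (fun j => pos_half (t * j))) //.
by rewrite (gauss_lemma p_pr p_gt2 t0) -(chiM oF) mulN1r.
Qed.

(* The ratios [t] and [1/t] together occur for #{j : j and tj in the lower half} pairs
   [i < j], a number whose parity Gauss's lemma gives. *)
Lemma triangle_sym a b :
  \prod_(j : F | pos_half j) \prod_(i : F | pos_half i && (i < j)%N)
    chi_nz (a * i ^+ 2 + b * (i * j) + a * j ^+ 2)
  = \prod_(x : F | (chi x == 1) && (chi (x - 1) == -1))
      chi_nz ((2 * a - b) * x + (2 * a + b)).
Proof.
have F2 : (2 : F) != 0 by apply: two_neq0 oF.
pose w t := chi_nz (a * t ^+ 2 + b * t + a).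
pose G t : int :=
  \prod_(j : F | pos_half j) (if pos_half (t * j) && ((t * j)%R < j)%N then w t else 1).
transitivity (\prod_(t : F | t != 0) G t).
  rewrite /G exchange_big /=; apply: eq_bigr => j /pos_half_neq0 j0.
  rewrite (prod_scale _ j0); last by rewrite pos_half0.
  apply: eq_bigr => t _; case: ifP => [_|_]; last by [].
  rewrite /w -(chi_nz_sqrM (a * t ^+ 2 + b * t + a) j0); congr chi_nz; ring.
have wV t : t != 0 -> w t^-1 = w t.
  move=> t0; rewrite /w -(chi_nz_sqrM _ t0); congr chi_nz; field; exact: t0.
(* After [j] is replaced by [t j], the ratio [1 / t] covers the [j] with [j < t j] and the ratio [t]
   those with [t j < j]; only the condition on halves remains. *)
have GV t : t != 0 -> t != 1 -> G t * G t^-1 = if chi (- t) == -1 then w t else 1.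
  move=> t0 t1; rewrite -(prod_if_pos_half t0 (chi_nz_pm _)).
  have -> : G t^-1 = \prod_(j : F | pos_half j)
      (if pos_half (t * j) && (j < (t * j)%R)%N then w t else 1).
    rewrite /G (reindex_inj (h := fun j => t * j) (mulfI t0)) [LHS]big_mkcond [RHS]big_mkcond.
    apply: eq_bigr => j _; rewrite (mulKf t0 j) (wV t t0).
    by case: (pos_half j); case: (pos_half (t * j)).
  rewrite -big_split; apply: eq_bigr => j /pos_half_neq0 j0.
  case: (ltngtP (t * j)%R j) => [_|_|/val_inj].
  - by case: (pos_half (t * j)); rewrite /= ?mulr1.
  - by case: (pos_half (t * j)); rewrite /= ?mul1r.
  by rewrite -[in RHS](mul1r j) => /(mulIf j0) /eqP; rewrite (negPf t1).
(* Ratio 1 never gives [i < j], and ratio -1 leaves the lower half. *)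
have G1 t : t ^+ 2 = 1 -> G t = 1.
  move=> /eqP; rewrite sqrf_eq1 /G => /orP[] /eqP ->; apply: big1 => j jp.
    by rewrite mul1r ltnn andbF.
  by rewrite mulN1r pos_halfN ?pos_half_neq0 // jp.
rewrite (bigID (fun t : F => t ^+ 2 != 1)) /= [X in _ * X]big1 ?mulr1 => [|t]; last first.
  by rewrite negbK => /andP[_ /eqP] /G1.
rewrite big_mobius [RHS]big_mkcondr /=.
rewrite -(big_half_sqr p_pr p_gt2 _ (fun x : F => if chi (x - 1) == -1 then
  chi_nz ((2 * a - b) * x + (2 * a + b)) else 1)).
rewrite [LHS]big_mkcondr /=; apply: eq_bigr => r rp.
have [->|r1] := eqVneq r 1; first by rewrite expr1n subrr chi0.
have rr : r ^+ 2 != 1 by rewrite sqr_eq1_pos.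
have r1' : 1 - r != 0 by rewrite subr_eq0 eq_sym.
have r2' : 1 + r != 0.
  by move: rr; rewrite sqrf_eq1 negb_or => /andP[_]; rewrite -addr_eq0 addrC.
rewrite /= GV; last 2 first.
- by rewrite mulf_neq0 ?invr_eq0.
- rewrite -subr_eq0 (_ : _ - 1 = 2 * r / (1 - r)); last by field.
  by rewrite !mulf_neq0 ?invr_eq0 // pos_half_neq0.
have -> : chi (- ((1 + r) / (1 - r))) = chi (r ^+ 2 - 1).
  rewrite (_ : - _ = (1 - r)^-1 ^+ 2 * (r ^+ 2 - 1)); last by field.
  by rewrite (chiM oF) (chi_sqr oF) ?mul1r // invr_eq0.
(* Multiplication by [(1 - r) ^+ 2] turns [a t^2 + b t + a] into [(2 a - b) r^2 + (2 a + b)]. *)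
congr (if _ then _ else _); rewrite /w -(chi_nz_sqrM _ r1'); congr chi_nz.
by field.
Qed.

(** The ratio [t = i / j] arises once for each [j] such that [j] and [t j] are both in the lower
    half. By Gauss's lemma their number is odd exactly for [chi (- t) = -1]. *)
Lemma square_product a b c :
  \prod_(j : F | pos_half j) \prod_(i : F | pos_half i)
    chi_nz (a * i ^+ 2 + b * (i * j) + c * j ^+ 2)
  = \prod_(t : F | chi (- t) == -1) chi_nz (a * t ^+ 2 + b * t + c).
Proof.
transitivity (\prod_(t : F | t != 0) \prod_(j : F | pos_half j)
   (if pos_half (t * j) then chi_nz (a * t ^+ 2 + b * t + c) else 1)).
  rewrite [RHS]exchange_big /=; apply: eq_bigr => j /pos_half_neq0 j0.
  rewrite (prod_scale _ j0); last by rewrite pos_half0.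
  apply: eq_bigr => t _; case: ifP => [_|_]; last by [].
  rewrite -(chi_nz_sqrM (a * t ^+ 2 + b * t + c) j0); congr chi_nz; ring.
rewrite big_mkcond [RHS]big_mkcond; apply: eq_bigr => t _.
have [->|t0] := eqVneq t 0; first by rewrite oppr0 chi0.
by rewrite /= (prod_if_pos_half t0 (chi_nz_pm _)).
Qed.

End HalfSystemProducts.

(** * The golden ratio modulo p *)

(* For a primitive fifth root of unity [z], the sign of [z^p - z^-p] relative to
   [z - z^-1] or [z^2 - z^-2]. *)
Definition eps5 (p : nat) : int := if (p %% 5 == 1)%N || (p %% 5 == 2)%N then 1 else -1.

(** For [p > 5] these are the primes modulo which 5 is a square ([chi_five]), so that the golden
    ratio lies in ['F_p]. *)
Definition golden_split (p : nat) := (p %% 5 == 1)%N || (p %% 5 == 4)%N.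

Lemma chi_rmorph (F : finFieldType) (oF : odd #|F|) (K : fieldType)
    (f : {rmorphism F -> K}) (x : F) (e : int) :
  sgn_val e -> f x ^+ #|F|./2 = e%:~R -> chi x = e.
Proof.
move=> se E; apply: chi_uniq => //; apply: (fmorph_inj f).
by rewrite rmorphXn /= E rmorph_int.
Qed.

Section Closure.

Variable p : nat.
Hypotheses (p_pr : prime p) (p_gt5 : (5 < p)%N).

Let p_gt2 : (2 < p)%N. Proof. by apply: leq_trans p_gt5. Qed.
Local Notation F := 'F_p.
Local Notation h := (p./2).
Local Notation oF := (odd_card_Fp p_pr p_gt2).

Lemma Fp_nat_neq0 n : (0 < n < p)%N -> (n%:R : F) != 0.
Proof.
move=> /andP[n0 np]; rewrite -(dvdn_pcharf (pchar_Fp p_pr)).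
by apply/negP => /(dvdn_leq n0); rewrite leqNgt np.
Qed.

Let F2 : (2 : F) != 0. Proof. by apply: (@Fp_nat_neq0 2); lia. Qed.
Let F5 : (5 : F) != 0. Proof. by apply: (@Fp_nat_neq0 5); lia. Qed.

Lemma frobD (K : fieldType) (f : {rmorphism F -> K}) (x y : K) :
  (x + y) ^+ p = x ^+ p + y ^+ p.
Proof.
have pK : p \in [pchar K] by rewrite (fmorph_pchar f) pchar_Fp.
by rewrite -!(pFrobenius_autE pK) rmorphD.
Qed.

Lemma frobN (K : comNzRingType) (x : K) : (- x) ^+ p = - x ^+ p.
Proof. by rewrite exprNn -signr_odd odd_p // mulN1r. Qed.

Lemma double_half_p : (h * 2 = p.-1)%N.
Proof. by have := p_eq p_pr p_gt2; lia. Qed.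

(** Frobenius supplies [x ^+ p]; when [x ^+ 2] comes from ['F_p], [y] is then its quadratic
    character. *)
Lemma frob_pred (K : fieldType) (x y : K) : x != 0 -> x ^+ p = y * x -> x ^+ h ^+ 2 = y.
Proof.
move=> x0 e; apply: (mulIf x0).
by rewrite -e -exprM double_half_p -exprSr prednK // prime_gt0.
Qed.

Definition chi2_val : int := if (p %% 8 == 1)%N || (p %% 8 == 7)%N then 1 else -1.

(** As [x ^+ 4 = -1], the element [w = x - x ^+ 3] is [x + 1 / x] for a primitive eighth root of
    unity, a square root of 2. *)
Lemma chi_two : chi (2 : F) = chi2_val.
Proof.
have [K [f _]] := countable_algebraic_closure F.
have [x xE] := @solve_monicpoly K 4 (fun i => if i == 0%N then -1 else 0) isT.
have x4 : x ^+ 4 = -1.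
  by rewrite xE !big_ord_recl big_ord0 /= !mul0r !addr0 expr0 mulr1.
pose w := x - x ^+ 3.
have w2 : w ^+ 2 = f 2.
  rewrite rmorph_nat (_ : w ^+ 2 = 2 + (x ^+ 4 + 1) * (x ^+ 2 - 2)); last by rewrite /w; ring.
  by rewrite x4 addNr mul0r addr0.
have w0 : w != 0 
  by apply/eqP=> w0; move/eqP: w2; rewrite w0 expr0n eq_sym fmorph_eq0 (negPf F2).
have x8 : x ^+ 8 = 1 by rewrite (exprM x 4 2) x4 sqrrN expr1n.
(* Equalities modulo [x ^+ 4 + 1] are left to [ring] once the quotient [q] is supplied. *)
have red (u v q : K) : u = v + (x ^+ 4 + 1) * q -> u = v.
  by rewrite x4 addNr mul0r addr0.
apply: (chi_rmorph oF (f := f)).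
  by rewrite /chi2_val; case: ifP; [constructor 2 | constructor 3].
rewrite card_Fp // -w2 -exprM mulnC exprM; apply: frob_pred => //.
have wp : w ^+ p = x ^+ (p %% 8) - x ^+ (p %% 8) ^+ 3.
  by rewrite (frobD f) frobN -[x ^+ 3 ^+ p]exprM mulnC exprM (expr_mod _ x8).
have pr : (p %% 8 \in [:: 1; 3; 5; 7])%N.
  by have := p_eq p_pr p_gt2; rewrite !inE; lia.
rewrite !inE in pr; rewrite wp /chi2_val /w; case/or4P: pr => /eqP -> /=.
- by ring.
- by apply: (red _ _ (- x * (x ^+ 4 - 1))); ring.
- by apply: (red _ _ (x - x ^+ 3 * (x ^+ 8 - x ^+ 4 + 1))); ring.
- apply: (red _ _ (x ^+ 3 - x * (x ^+ 16 - x ^+ 12 + x ^+ 8 - x ^+ 4 + 1))); ring.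
Qed.

(* For a primitive fifth root of unity [z], take [a = z + z^4], [b = -(z^2 + z^3)]
   (the golden ratio) and [g = z - z^4]; then [a + b] is a square root of 5. *)
Lemma golden_exists : exists (K : closedFieldType) (f : {rmorphism F -> K}) (a b g : K),
  [/\ b = a + 1, a * b = 1, g ^+ 2 = - (b * (a + b)) &
    if golden_split p then [/\ a ^+ p = a, b ^+ p = b & g ^+ p = (eps5 p)%:~R * g]
    else [/\ a ^+ p = - b, b ^+ p = - a & g ^+ p = (eps5 p)%:~R * a * g]].
Proof.
have [K [f _]] := countable_algebraic_closure F; exists K, f.
have [z zE] := @solve_monicpoly K 4 (fun=> -1) isT.
have Z : 1 + z + z ^+ 2 + z ^+ 3 + z ^+ 4 = 0.
  by rewrite zE !big_ord_recl big_ord0 /= /bump /=; ring.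
have z5 : z ^+ 5 = 1.
  apply/eqP; rewrite -subr_eq0; apply/eqP.
  by rewrite -[RHS](mulr0 (z - 1)) -Z; ring.
have red (x y q : K) : x = y + (1 + z + z ^+ 2 + z ^+ 3 + z ^+ 4) * q -> x = y.
  by rewrite Z mul0r addr0.
exists (z + z ^+ 4), (- (z ^+ 2 + z ^+ 3)), (z - z ^+ 4); split.
- by apply: (red _ _ (-1)); ring.
- by apply: (red _ _ (- (z ^+ 3 - z + 1))); ring.
- by apply: (red _ _ ((z - 1) ^+ 2 * z ^+ 2)); ring.
have pr : (p %% 5 \in [:: 1; 2; 3; 4])%N.
  have : (p %% 5 != 0)%N.
    by rewrite -/(dvdn 5 p) dvdn_prime2 //; lia.
  by rewrite !inE; lia.
rewrite !inE in pr; rewrite /golden_split /eps5 !(frobD f) !frobN !(frobD f).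
rewrite -!(exprM z) ![(_ * p)%N]mulnC !(exprM z p) -(expr_mod p z5).
case/or4P: pr => /eqP -> /=; split.
- by ring.
- by ring.
- by ring.
- by apply: (red _ _ (z ^+ 3 * (z - 1))); ring.
- by apply: (red _ _ (- z * (z - 1))); ring.
- by ring.
- by apply: (red _ _ (z ^+ 2 * (z - 1) * (z ^+ 5 + 1))); ring.
- by apply: (red _ _ (- (z - 1) * (z + z ^+ 4))); ring.
- by apply: (red _ _ (- (z - 1) * z ^+ 3 - z ^+ 2 * (z - 1) * (z ^+ 5 + 1))); ring.
- by apply: (red _ _ (z * (z - 1) * (z ^+ 10 + z ^+ 5 + 1))); ring.
- by apply: (red _ _ (- (z - 1) * z ^+ 3 - z ^+ 2 * (z - 1) * (z ^+ 5 + 1))); ring.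
- by apply: (red _ _ (- z * (z - 1) * (z ^+ 10 + z ^+ 5 + 1))); ring.
Qed.

(** * The product over the nonresidues, evaluated at the golden ratio *)

Definition core_set (F : finFieldType) : pred F :=
  fun x => (chi x == 1) && (chi (1 - x) == -1).

(* For [x = r^2] and [t = (1+r)/(1-r)] the factor is [3 - (t + 1/t)]. *)
Definition core_prod (F : finFieldType) : F :=
  \prod_(x | core_set x) ((1 - 5 * x) / (1 - x)).

(** For [t = (1 + r) / (1 - r)] one has [chi t = chi (1 - r ^+ 2)], so the pairs [t], [1 / t] of
    nonresidues other than -1 correspond to the [x = r ^+ 2] in [core_set]. *)
Lemma big_chiN1_mobius (R : Type) (idx : R) (op : Monoid.com_law idx) (g : F -> R) (g2 : F -> R) :
  (forall r : F, r ^+ 2 != 1 ->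
     op (g ((1 + r) / (1 - r))) (g ((1 + r) / (1 - r))^-1) = g2 (r ^+ 2)) ->
  \big[op/idx]_(t : F | (chi t == -1) && (t ^+ 2 != 1)) g t
  = \big[op/idx]_(x : F | core_set x) g2 x.
Proof.
move=> gE; transitivity (\big[op/idx]_(t : F | (t != 0) && (t ^+ 2 != 1))
  (if chi t == -1 then g t else idx)).
  rewrite [RHS]big_mkcond [LHS]big_mkcond; apply: eq_bigr => t _.
  have [->|t0] := eqVneq t 0; first by rewrite chi0.
  by case: (t ^+ 2 != 1); rewrite ?andbT ?andbF.
rewrite (big_mobius p_pr p_gt2) [RHS]big_mkcondr.
rewrite -(big_half_sqr p_pr p_gt2 _ (fun x : F => if chi (1 - x) == -1 then g2 x else idx)).
rewrite big_mkcondr; apply: eq_bigr => r rp.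
have [->|r1] := eqVneq r 1; first by rewrite expr1n subrr chi0.
have r1' : 1 - r != 0 by rewrite subr_eq0 eq_sym.
have rr : r ^+ 2 != 1 by rewrite sqr_eq1_pos.
have -> : chi (1 - r ^+ 2) = chi ((1 + r) / (1 - r)).
  rewrite (_ : 1 - r ^+ 2 = (1 - r) ^+ 2 * ((1 + r) / (1 - r))); last by field.
  by rewrite (chiM oF) (chi_sqr oF) ?mul1r.
rewrite (chiV oF); case: (_ == -1) => /=; last by rewrite Monoid.mul1m.
exact: gE.
Qed.

Lemma chi_N1_odd : chi (-1 : F) = if odd h then -1 else 1.
Proof. by rewrite (chiN1 oF) card_Fp // -signr_odd; case: odd. Qed.

Lemma big_chiN1_sqr1 (R : Type) (idx : R) (op : Monoid.com_law idx) (g : F -> R) :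
  \big[op/idx]_(t : F | (chi t == -1) && (t ^+ 2 == 1)) g t = if odd h then g (-1) else idx.
Proof.
have E (t : F) : (chi t == -1) && (t ^+ 2 == 1) = (t == -1) && odd h.
  rewrite sqrf_eq1; have [->|tN1] := eqVneq t (-1).
    by rewrite chi_N1_odd orbT andbT; case: odd.
  rewrite orbF andbC; case: eqP => // ->; by rewrite chi1.
rewrite (eq_bigl _ _ E); case: (odd h).
  by apply: big_pred1 => t; rewrite andbT.
by apply: big_pred0 => t; rewrite andbF.
Qed.

(** The [h] nonresidues fall into pairs [t], [1 / t], apart from -1, which is one of them exactly
    when [h] is odd. *)
Lemma card_core : #|[pred x : F | core_set x]| = h./2.
Proof.
have E1 : #|[set t : F | chi t == -1]| = h by rewrite (card_chiN1 oF) card_Fp.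
move: E1; rewrite -sum1dep_card (bigID (fun t : F => t ^+ 2 == 1)) /=.
rewrite (big_chiN1_sqr1 _ (fun=> 1%N)) (@big_chiN1_mobius _ _ _ _ (fun=> 2%N)) //.
rewrite sum_nat_const; set n := (X in (X * 2)%N).
have -> : #|[pred x : F | core_set x]| = n by apply: eq_card.
by move=> <-; case: (odd h); rewrite /=; lia.
Qed.

(** The left side is the product of [w - t] over the nonresidues [t]. A pair gives [(w - t) (w - 1 /
    t) = w (3 - (t + 1 / t))] because [w + 1 / w = 3]; an unpaired [t = -1] gives [w + 1]. *)
Lemma core_prod_rmorph (K : fieldType) (f : {rmorphism F -> K}) (w : K) :
  w != 0 -> w + w^-1 = 3 ->
  w ^+ h + 1 = (if odd h then w + 1 else 1) * (w ^+ h./2 * f (core_prod F)).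
Proof.
move=> w0 w3; rewrite -{1}[h]/(p./2) -[p in w ^+ p./2](card_Fp p_pr) -(prod_sub_chiN1 oF f).
rewrite (bigID (fun t : F => t ^+ 2 == 1)) /= big_chiN1_sqr1 rmorphN1 opprK.
congr (_ * _).
rewrite (@big_chiN1_mobius _ _ _ _ (fun x => w * f ((1 - 5 * x) / (1 - x)))); last first.
  move=> r; rewrite sqrf_eq1 negb_or => /andP[r1 rN1].
  have r1' : 1 - r != 0 by rewrite subr_eq0 eq_sym.
  have r2' : 1 + r != 0 by rewrite addrC addr_eq0.
  have -> : (1 - 5 * r ^+ 2) / (1 - r ^+ 2) =
     3 - ((1 + r) / (1 - r) + ((1 + r) / (1 - r))^-1).
    by field; rewrite r1' r2' (_ : 1 - r ^+ 2 = (1 - r) * (1 + r)) ?mulf_neq0 //; ring.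
  set t := (1 + r) / (1 - r); have t0 : t != 0 by rewrite mulf_neq0 ?invr_eq0.
  have ft : f t * f t^-1 = 1 by rewrite -rmorphM mulfV // rmorph1.
  rewrite rmorphB rmorph_nat (rmorphD f t) -w3 /=.
  transitivity (w ^+ 2 - w * (f t + f t^-1) + f t * f t^-1); first by ring.
  by rewrite ft; field; rewrite fmorph_eq0 t0.
by rewrite /= big_split /= prodr_const rmorph_prod -card_core.
Qed.

Definition core_sign : int :=
  if ~~ odd h then (-1) ^+ h./2
  else if golden_split p then - chi2_val * eps5 p else - (-1) ^+ h./2 * eps5 p.

Lemma exprN_odd (R : comNzRingType) (x : R) n : odd n -> (- x) ^+ n = - x ^+ n.
Proof. by move=> on; rewrite exprNn -signr_odd on mulN1r. Qed.

Lemma chi2_val_even : ~~ odd h -> chi2_val = (-1) ^+ h./2.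
Proof.
move=> eh; rewrite /chi2_val -signr_odd; have pE := p_eq p_pr p_gt2.
case: ifP => c; case: (boolP (odd h./2)) => d //; exfalso; move: c d; lia.
Qed.

Lemma eps5_sgn : sgn_val (eps5 p).
Proof. by rewrite /eps5; case: ifP; [constructor 2 | constructor 3]. Qed.

Lemma chi2_val_sgn : sgn_val chi2_val.
Proof. by rewrite /chi2_val; case: ifP; [constructor 2 | constructor 3]. Qed.

Lemma sign_sgn n : sgn_val ((-1) ^+ n).
Proof. by rewrite -signr_odd; case: odd; [constructor 3 | constructor 2]. Qed.

Lemma sgn_valN (e : int) : sgn_val e -> sgn_val (- e).
Proof. by case=> ->; [constructor 1 | constructor 3 | constructor 2]. Qed.

Section Golden.

Variables (K : fieldType) (f : {rmorphism F -> K}) (a b g : K).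
Hypotheses (ba : b = a + 1) (ab : a * b = 1) (g2 : g ^+ 2 = - (b * (a + b))).

Let a0 : a != 0.
Proof. by apply: contra_eq_neq ab => ->; rewrite mul0r eq_sym oner_eq0. Qed.

Let b0 : b != 0.
Proof. by apply: contra_eq_neq ab => ->; rewrite mulr0 eq_sym oner_eq0. Qed.

Lemma golden_D2 : (a + b) ^+ 2 = f 5.
Proof.
rewrite rmorph_nat; transitivity ((b - a) ^+ 2 + 4 * (a * b)); first by ring.
by rewrite ab ba; ring.
Qed.

Lemma golden_D_neq0 : a + b != 0.
Proof.
apply/eqP=> D0; have := golden_D2; rewrite D0 expr0n => /esym/eqP.
by rewrite fmorph_eq0 (negPf F5).
Qed.

Let D0 := golden_D_neq0.

Lemma golden_g_neq0 : g != 0.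
Proof.
apply/eqP=> g0; have /eqP := g2; rewrite g0 expr0n eq_sym oppr_eq0 mulf_eq0.
by rewrite (negPf b0) (negPf D0).
Qed.

Let g0 := golden_g_neq0.

Lemma golden_sum2 : a ^+ 2 + b ^+ 2 = 3.
Proof.
transitivity ((b - a) ^+ 2 + 2 * (a * b)); first by ring.
by rewrite ab ba; ring.
Qed.

Let abh : a ^+ h * b ^+ h = 1.
Proof. by rewrite -exprMn ab expr1n. Qed.

(** Take [w = b ^+ 2], for which [w + w^-1 = b ^+ 2 + a ^+ 2 = 3], and multiply by [a ^+ h], the
    inverse of [b ^+ h]. *)
Lemma golden_core_even : ~~ odd h -> f (core_prod F) = b ^+ h + a ^+ h.
Proof.
move=> eh; have w0 : b ^+ 2 != 0 by rewrite expf_neq0.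
have wV : (b ^+ 2)^-1 = a ^+ 2.
  by apply: (mulfI w0); rewrite mulfV // -exprMn mulrC ab expr1n.
have := core_prod_rmorph f w0; rewrite wV addrC golden_sum2 => /(_ erefl).
rewrite (negPf eh) mul1r -!exprM (_ : (2 * h./2)%N = h); last by lia.
move=> /(congr1 (fun x => a ^+ h * x)); rewrite mulrA abh mul1r => <-.
by rewrite mul2n -addnn exprD mulrDr mulrA abh mul1r mulr1.
Qed.

(** The unpaired factor is [b ^+ 2 + 1 = b * (a + b)]; its [b] completes [b ^+ h.-1] to [b ^+ h]. *)
Lemma golden_core_odd : odd h -> (a + b) * f (core_prod F) = b ^+ h + a ^+ h.
Proof.
move=> oh; have w0 : b ^+ 2 != 0 by rewrite expf_neq0.
have wV : (b ^+ 2)^-1 = a ^+ 2.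
  by apply: (mulfI w0); rewrite mulfV // -exprMn mulrC ab expr1n.
have := core_prod_rmorph f w0; rewrite wV addrC golden_sum2 => /(_ erefl).
rewrite oh (_ : b ^+ 2 + 1 = b * (a + b)); last by rewrite -ab; ring.
rewrite -!exprM => /(congr1 (fun x => a ^+ h * x)).
rewrite mul2n -addnn exprD mulrDr mulrA abh mul1r mulr1 => ->.
transitivity (a ^+ h * (b * b ^+ (2 * h./2)) * ((a + b) * f (core_prod F))); last by ring.
by rewrite -exprS (_ : (2 * h./2).+1 = h) ?abh ?mul1r //; lia.
Qed.

Lemma golden_g_half : odd h -> (b * (a + b)) ^+ h = - (g ^+ h) ^+ 2.
Proof.
move=> oh; rewrite -[b * _]opprK -g2 exprN_odd //.
by rewrite -!exprM mulnC.
Qed.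

Section Split.
Hypotheses (fa : a ^+ p = a) (fb : b ^+ p = b) (fg : g ^+ p = (eps5 p)%:~R * g).

Let ah2 : (a ^+ h) ^+ 2 = 1. Proof. by apply: frob_pred => //; rewrite mul1r. Qed.
Let bh2 : (b ^+ h) ^+ 2 = 1. Proof. by apply: frob_pred => //; rewrite mul1r. Qed.

Let bh_ah : b ^+ h = a ^+ h.
Proof. by rewrite -[LHS]mul1r -ah2 expr2 -mulrA abh mulr1. Qed.

(** Here [b ^+ h = a ^+ h] is a sign, so the product is 2 or -2, and -1 is a square. *)
Lemma split_core_even : ~~ odd h -> chi (core_prod F) = chi2_val.
Proof.
move=> eh; have : f (core_prod F) ^+ 2 = f (2 ^+ 2).
  rewrite golden_core_even // -bh_ah rmorphXn rmorph_nat.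
  by transitivity ((b ^+ h) ^+ 2 * 2 ^+ 2); [ring | rewrite bh2 mul1r].
rewrite -rmorphXn => /fmorph_inj/eqP; rewrite eqf_sqr => /orP[] /eqP ->.
  exact: chi_two.
by rewrite -mulN1r (chiM oF) chi_N1_odd (negPf eh) mul1r chi_two.
Qed.

Lemma split_D : (a + b) ^+ p = a + b -> ((a + b) ^+ h) ^+ 2 = 1.
Proof. by move=> e; apply: frob_pred => //; rewrite mul1r. Qed.

(** The product times [a + b] is [2 * b ^+ h], where [b ^+ h] is a sign. In the [h]-th power [b] and
    [a + b] combine to [(b * (a + b)) ^+ h], which is known from [g]. *)
Lemma split_core_odd : (a + b) ^+ p = a + b -> odd h ->
  chi (core_prod F) = - chi2_val * eps5 p.
Proof.
move=> fD oh; apply: (chi_rmorph oF (f := f)).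
  by apply: sgn_valM; [apply: sgn_valN; apply: chi2_val_sgn | apply: eps5_sgn].
rewrite card_Fp // rmorphM rmorphN /= -(rmorph_int f chi2_val) -chi_two chiE ?oF //.
rewrite card_Fp // rmorphXn rmorph_nat /=.
have bhh : b ^+ h ^+ h = b ^+ h.
  have hE : h = (h./2 * 2).+1 by lia.
  by rewrite {2}hE exprS mulnC exprM bh2 expr1n mulr1.
transitivity (((a + b) * f (core_prod F)) ^+ h * (a + b) ^+ h).
  rewrite exprMn mulrAC -[X in X * _]expr2 split_D // mul1r //.
rewrite golden_core_odd // -bh_ah (_ : b ^+ h + b ^+ h = 2 * b ^+ h); last by ring.
rewrite exprMn bhh -mulrA -exprMn.
by rewrite golden_g_half // (frob_pred g0 fg); ring.
Qed.

End Split.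

Section Inert.
Hypotheses (fa : a ^+ p = - b) (fb : b ^+ p = - a) (fg : g ^+ p = (eps5 p)%:~R * a * g).

Let ah2 : (a ^+ h) ^+ 2 = - b ^+ 2.
Proof.
by apply: frob_pred => //; rewrite fa -[in LHS](mulr1 b) -ab; ring.
Qed.
Let bh2 : (b ^+ h) ^+ 2 = - a ^+ 2.
Proof.
by apply: frob_pred => //; rewrite fb -[in LHS](mulr1 a) -ab; ring.
Qed.

(** The square of the product is [2 - (a ^+ 2 + b ^+ 2) = -1]. *)
Lemma inert_core_even : ~~ odd h -> chi (core_prod F) = (-1) ^+ h./2.
Proof.
move=> eh; apply: (chi_rmorph oF (f := f)); first exact: sign_sgn.
have P2 : f (core_prod F) ^+ 2 = -1.
  rewrite golden_core_even //.
  transitivity (b ^+ h ^+ 2 + a ^+ h ^+ 2 + 2 * (a ^+ h * b ^+ h)); first by ring.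
  by rewrite ah2 bh2 abh -opprD golden_sum2; ring.
have hE : h = (2 * h./2)%N by lia.
by rewrite card_Fp // {1}hE exprM P2 rmorphXn /= mulrN1z.
Qed.

(** A square root of -1, in terms of which both [a ^+ h] and [b ^+ h] are expressed. *)
Let J := b * b ^+ h.

Let J2 : J ^+ 2 = -1.
Proof. by rewrite exprMn bh2 mulrN -exprMn mulrC ab expr1n. Qed.

Let bhJ : b ^+ h = a * J.
Proof. by rewrite /J mulrA ab mul1r. Qed.

Let ahJ : a ^+ h = - (b * J).
Proof.
have B0 : b ^+ h != 0 by rewrite expf_neq0.
apply: (mulIf B0); rewrite abh bhJ.
by transitivity (- (a * b) * J ^+ 2); [rewrite ab J2; ring | ring].
Qed.

Let D2 : (a + b) ^+ p = - (a + b) -> ((a + b) ^+ h) ^+ 2 = -1.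
Proof. by move=> e; apply: frob_pred => //; rewrite e mulN1r. Qed.

Let JhE : odd h -> J ^+ h = (-1) ^+ h./2 * J.
Proof.
move=> oh; have hE : h = (2 * h./2).+1 by lia.
by rewrite {1}hE exprS exprM J2 mulrC.
Qed.

Let JDh : odd h -> J ^+ h * (a + b) ^+ h = (- (-1) ^+ h./2 * eps5 p)%:~R.
Proof.
move=> oh; rewrite JhE // /J -!mulrA -exprMn golden_g_half // (frob_pred g0 fg).
rewrite rmorphM rmorphN rmorphXn /= mulrN1z.
transitivity (- (-1) ^+ h./2 * (eps5 p)%:~R * (a * b)); first by ring.
by rewrite ab mulr1.
Qed.

(** Since [b = a + 1], the sum [b ^+ h + a ^+ h = (a - b) * J] is [- J]; moreover [(a + b) ^+ h]
    squares to -1. *)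
Lemma inert_core_odd : (a + b) ^+ p = - (a + b) -> odd h ->
  chi (core_prod F) = - (-1) ^+ h./2 * eps5 p.
Proof.
move=> fD oh; apply: (chi_rmorph oF (f := f)).
  by apply: sgn_valM; [apply: sgn_valN; apply: sign_sgn | apply: eps5_sgn].
rewrite card_Fp // -JDh //.
have : ((a + b) * f (core_prod F)) ^+ h * (a + b) ^+ h = (- J) ^+ h * (a + b) ^+ h.
  rewrite golden_core_odd // bhJ ahJ -mulNr -mulrDl ba opprD addrA subrr add0r.
  by rewrite mulN1r.
rewrite exprMn mulrAC -[X in X * _]expr2 D2 // mulN1r exprN_odd // mulNr.
by move/oppr_inj.
Qed.

(** As [b] and [- a] are the roots of [t ^+ 2 - t - 1], the left side is the product of this
    polynomial over the nonzero squares [t], by [prod_sub_chi1]. *)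
Lemma inert_square : odd h ->
  (b ^+ h - 1) * ((- a) ^+ h - 1) = - (J * (a + b)).
Proof.
move=> oh; rewrite exprN_odd //.
transitivity (- (a ^+ h * b ^+ h) - b ^+ h + a ^+ h + 1); first by ring.
by rewrite abh bhJ ahJ; ring.
Qed.

Lemma inert_square_half : odd h ->
  (- (J * (a + b))) ^+ h = ((-1) ^+ h./2 * eps5 p)%:~R.
Proof.
by move=> oh; rewrite exprN_odd // exprMn JDh // mulNr rmorphN opprK.
Qed.

End Inert.

End Golden.

Lemma chi_core_prod : chi (core_prod F) = core_sign.
Proof.
have [K [f [a [b [g [ba ab g2 fr]]]]]] := golden_exists; rewrite /core_sign.
case: (boolP (golden_split p)) fr => _ [fa fb fg]; case: (boolP (odd h)) => oh /=.
- by apply: (split_core_odd f ba ab g2 fa fb fg); rewrite ?(frobD f) ?fa ?fb.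
- by rewrite (split_core_even f ba ab g2 fa fb) // chi2_val_even.
- by apply: (inert_core_odd f ba ab g2 fb fg); rewrite ?(frobD f) ?fa ?fb // addrC opprD.
- exact: (inert_core_even f ba ab g2 fa fb).
Qed.

Definition chi5_val : int := if golden_split p then 1 else -1.

Lemma chi_five : chi (5 : F) = chi5_val.
Proof.
have [K [f [a [b [g [ba ab g2 fr]]]]]] := golden_exists; rewrite /chi5_val.
have D5 := golden_D2 f ba ab.
have D0 : a + b != 0.
  by apply/eqP=> D0; move/eqP: D5; rewrite D0 expr0n eq_sym fmorph_eq0 (negPf F5).
apply: (chi_rmorph oF (f := f)); first by case: ifP; [constructor 2 | constructor 3].
rewrite card_Fp // -D5 -exprM mulnC exprM; apply: frob_pred => //.
rewrite (frobD f); case: (golden_split p) fr => [[-> -> _]|[-> -> _]].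
  by rewrite mul1r.
by rewrite mulN1r opprD addrC.
Qed.

Lemma eq_mul_sign (e s : int) : e = 1 \/ e = -1 -> (e * s == - e) = (s == -1).
Proof. by case=> ->; rewrite ?mul1r // mulN1r eqr_opp. Qed.

Lemma prod_const_card (T : finType) (P : pred T) (e : int) :
  \prod_(x | P x) e = e ^+ #|[set x | P x]|.
Proof. by rewrite prodr_const; congr (e ^+ _); apply: eq_card => x; rewrite inE. Qed.

(** On [core_set] one has [chi (1 - x) = -1], so with one extra sign per element each factor
    contributes [chi (1 - 5 x)]. The pattern selects the [x] where this is -1. *)
Lemma core_count :
  (-1) ^+ #|[set x : F | pattern 1 (- chi (-1 : F)) (- chi (-5 : F)) (5^-1) x]|
    = core_sign * (-1) ^+ h./2.
Proof.
have N1 : (-1 : F) != 0 by rewrite oppr_eq0 oner_eq0.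
have N5 : (-5 : F) != 0 by rewrite oppr_eq0.
have -> : (-1) ^+ h./2 = \prod_(x : F | core_set x) (-1) :> int.
  by rewrite prodr_const -card_core.
rewrite -chi_core_prod /core_prod (chi_prod oF) -big_split /= -prod_const_card.
rewrite [LHS]big_mkcond [RHS]big_mkcond; apply: eq_bigr => x _.
have E1 : chi (x - 1) = chi (-1 : F) * chi (1 - x) by rewrite -(chiM oF) mulN1r opprB.
have E5 : chi (x - 5^-1) = chi (-5 : F) * chi (1 - 5 * x).
  rewrite -(chiM oF) (_ : -5 * (1 - 5 * x) = 5 ^+ 2 * (x - 5^-1)); last by field.
  by rewrite (chiM oF) (chi_sqr oF) ?mul1r.
rewrite /pattern E1 E5 !eq_mul_sign; [|exact: chi_pm|exact: chi_pm].
rewrite /core_set; case: (chi x =P 1) => [x1|_]; last by [].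
case: (chi (1 - x) =P -1) => [xN1|_]; last by [].
have x10 : 1 - x != 0 by rewrite -chi_eq0 xN1.
rewrite (chiM oF) (chiV oF) xN1 mulrN1 mulrN1 opprK.
(* The point [1 / 5] is not in [core_set], because [1 - 1 / 5 = 4 / 5] has the same character as
   [1 / 5]. *)
have : chi (1 - 5 * x) != 0.
  rewrite chi_eq0; apply/eqP=> x5; have xE : x = 5^-1.
    by apply: (mulfI F5); rewrite mulfV //; apply/esym/eqP; rewrite -subr_eq0 x5.
  move: xN1 x1; rewrite xE (_ : 1 - 5^-1 = 2 ^+ 2 * 5^-1); last by field.
  by rewrite (chiM oF) (chi_sqr oF) // mul1r => ->.
by case: (chi_sgn (1 - 5 * x)) => ->.
Qed.

(** * The product over the full square of pairs *)

Definition square_sign : int :=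
  if ~~ odd h then (if odd h./2 then chi5_val else 1)
  else if golden_split p then eps5 p else (-1) ^+ h./2 * eps5 p.

Lemma rmorph_fixed (K : fieldType) (f : {rmorphism F -> K}) (y : K) :
  y ^+ p = y -> exists x : F, y = f x.
Proof.
move=> yp; have : root (map_poly f ('X^#|F| - 'X)) y.
  by rewrite rmorphB /= map_polyXn map_polyX rootE !hornerE card_Fp // yp subrr.
rewrite finField_genPoly rmorph_prod /= rootE horner_prod prodf_seq_eq0.
by case/hasP=> x _ /=; rewrite map_polyXsubC hornerXsubC subr_eq0 => /eqP ->; exists x.
Qed.

(** With [-1 = i ^+ 2] and [t = i s] the polynomial becomes [- s ^+ 2 - i s - 1], whose character is
    invariant under [s -> 1 / s]. Only [s = 1] and [s = -1] can survive; they are in the range when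
    [chi i = -1], and contribute [chi 5]. *)
Lemma square_even : ~~ odd h ->
  \prod_(t : F | chi (- t) == -1) chi_nz (t ^+ 2 - t - 1) = square_sign.
Proof.
move=> eh; rewrite /square_sign eh.
have cN1 : chi (-1 : F) = 1 by rewrite chi_N1_odd (negPf eh).
have [i i0 i2] := chi_exists_sqrt oF cN1.
have ci : chi i = (-1) ^+ h./2.
  apply: (chi_uniq oF); first exact: sign_sgn.
  have hE : h = (2 * h./2)%N by lia.
  by rewrite card_Fp // {1}hE exprM -i2 rmorphXn /= mulrN1z.
pose w s := chi_nz (- s ^+ 2 - i * s - 1).
have wV s : s != 0 -> w s^-1 = w s.
  move=> s0; rewrite /w -(chi_nz_sqrM p_pr p_gt2 _ s0); congr chi_nz; field; exact: s0.
rewrite (reindex_inj (mulfI i0)).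
transitivity (\prod_(s : F | chi i * chi s == -1) w s).
  apply: eq_big => [s | s _].
    by rewrite -[- (i * s)]mulN1r !(chiM oF) cN1 mul1r.
  by rewrite /w exprMn -i2 mulN1r.
rewrite (bigID (fun s : F => s ^+ 2 != 1)) /=.
have -> : \prod_(s : F | (chi i * chi s == -1) && (s ^+ 2 != 1)) w s = 1.
  transitivity (\prod_(t : F | (t != 0) && (t ^+ 2 != 1))
      (if chi i * chi t == -1 then w t else 1)).
    rewrite [LHS]big_mkcond [RHS]big_mkcond; apply: eq_bigr => t _.
    have [->|t0] := eqVneq t 0; first by rewrite chi0 mulr0.
    by case: (t ^+ 2 != 1); rewrite ?andbT ?andbF.
  rewrite (big_mobius p_pr p_gt2); apply: big1 => r /andP[rp r1].
  have rr : r ^+ 2 != 1 by rewrite sqr_eq1_pos.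
  have t0 : (1 + r) / (1 - r) != 0.
    move: rr; rewrite sqrf_eq1 negb_or => /andP[r1' rN1].
    have r2' : 1 + r != 0 by rewrite addrC addr_eq0.
    by rewrite mulf_neq0 // invr_eq0 subr_eq0 eq_sym.
  rewrite /= (chiV oF) wV //; case: eqP => _; last by rewrite mul1r.
  by rewrite /w; case: (chi_nz_pm (- ((1 + r) / (1 - r)) ^+ 2 - i * ((1 + r) / (1 - r)) - 1)) => ->.
rewrite mul1r.
have -> : \prod_(s : F | (chi i * chi s == -1) && ~~ (s ^+ 2 != 1)) w s
   = if chi i == -1 then w 1 * w (-1) else 1.
  have E (s : F) : (chi i * chi s == -1) && ~~ (s ^+ 2 != 1) =
      ((s == 1) || (s == -1)) && (chi i == -1).
    rewrite negbK sqrf_eq1 andbC; case: (boolP (_ || _)) => //= /orP[] /eqP ->.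
      by rewrite chi1 mulr1.
    by rewrite cN1 mulr1.
  rewrite (eq_bigl _ _ E); case: (chi i == -1); last first.
    by rewrite big_pred0 // => s; rewrite andbF.
  rewrite (bigD1 1) //= (bigD1 (-1)) ?eqxx ?orbT ?(neg1_neq1 oF) //= big1 ?mulr1 // => s.
  by rewrite andbT => /andP[/andP[/orP[] /eqP -> ]]; rewrite ?eqxx.
rewrite ci -signr_odd; case: (odd h./2) => //=.
have p5 : (- 1 ^+ 2 - i * 1 - 1) * (- (-1) ^+ 2 - i * -1 - 1) = 5 :> F.
  transitivity (4 - i ^+ 2); first by ring.
  by rewrite -i2; ring.
move: F5; rewrite -chi_five -p5 mulf_eq0 negb_or => /andP[/negPf w1 /negPf wN1].
by rewrite (chiM oF) /w /chi_nz w1 wN1.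
Qed.

(** Both sides are the derivative of ['X^h - 1] at its root [r]. *)
Lemma prod_chi1_deriv (r : F) : chi r = 1 ->
  \prod_(t : F | (chi t == 1) && (t != r)) (r - t) = h%:R * r ^+ h.-1.
Proof.
move=> r1; have := @prod_XsubC_half F oF 1 (expr1n _ _).
rewrite (bigD1 r) /=; last by rewrite -chi_eq1 ?oF // r1.
move/(congr1 (fun P : {poly F} => P^`().[r])).
rewrite derivM derivXsubC mul1r hornerD hornerM hornerXsubC subrr mul0r addr0.
rewrite derivB derivC subr0 derivXn hornerMn hornerXn card_Fp // -[RHS]mulr_natl => <-.
rewrite horner_prod; apply: eq_big => [t|t _]; last by rewrite hornerXsubC.
by rewrite chi_eq1 ?oF // card_Fp.
Qed.

(** The zero factor at [t = r] counts as 1. Over the other squares [t], the products of [r - t] and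
    of [s - t] have characters [- chi 2] and [- chi 2 * chi (s - r)], by [prod_chi1_deriv] with
    [2 h = -1] and by [s ^+ h - 1 = -2]. *)
Lemma split_square (r s : F) : odd h -> chi r = 1 -> chi s = -1 ->
  \prod_(t : F | chi t == 1) chi_nz ((r - t) * (s - t)) = chi (s - r).
Proof.
move=> oh r1 s1; have N1 : chi (-1 : F) = -1 by rewrite chi_N1_odd oh.
have sr : s - r != 0.
  by rewrite subr_eq0; apply: contra_eq_neq s1 => ->; rewrite r1.
rewrite (bigD1 r) /= ?r1 // subrr mul0r {1}/chi_nz eqxx mul1r.
transitivity (chi (\prod_(t : F | (chi t == 1) && (t != r)) (r - t)) *
              chi (\prod_(t : F | (chi t == 1) && (t != r)) (s - t))).
  rewrite !(chi_prod oF) -big_split /=; apply: eq_bigr => t /andP[/eqP t1 tr].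
  rewrite /chi_nz mulf_eq0 !subr_eq0 eq_sym (negPf tr) /= (chiM oF).
  by case: eqP => // st; move: s1; rewrite st t1.
have c2 : chi (2 : F) * chi (2 : F) = 1 by rewrite chi_sqr1.
have -> : chi (\prod_(t : F | (chi t == 1) && (t != r)) (r - t)) = - chi (2 : F).
  rewrite prod_chi1_deriv // (chiM oF) (chiX oF) r1 expr1n mulr1.
  have : chi (2 : F) * chi (h%:R : F) = -1.
    rewrite -(chiM oF) -N1 -natrM mulnC double_half_p; congr chi.
    by rewrite -subn1 natrB ?prime_gt0 // pchar_Fp_0 // sub0r.
  by move/(congr1 (fun x => chi (2 : F) * x)); rewrite mulrA c2 mul1r mulrN1.
have : \prod_(t : F | chi t == 1) (s - t) = -2.
  rewrite (prod_sub_chi1 oF idfun s); have := chiE oF s.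
  by rewrite s1 => <-; ring.
rewrite (bigD1 r) /= ?r1 // => /(congr1 (@chi F)).
rewrite (chiM oF) -[-2]mulN1r (chiM oF) N1 mulN1r.
move/(congr1 (fun x => chi (s - r) * x)); rewrite mulrA chi_sqr1 // mul1r => ->.
transitivity (chi (2 : F) * chi (2 : F) * chi (s - r)); first by ring.
by rewrite c2 mul1r.
Qed.

Lemma square_odd : odd h ->
  \prod_(t : F | chi (- t) == -1) chi_nz (t ^+ 2 - t - 1) = square_sign.
Proof.
move=> oh; rewrite /square_sign oh /=.
have N1 : chi (-1 : F) = -1 by rewrite chi_N1_odd oh.
have [K [f [a [b [g [ba ab g2 fr]]]]]] := golden_exists.
transitivity (\prod_(t : F | chi t == 1) chi_nz (t ^+ 2 - t - 1)).
  by apply: eq_bigl => t; rewrite -[- t]mulN1r (chiM oF) N1 mulN1r eqr_opp.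
have c5 := chi_five; rewrite /chi5_val in c5.
case: (golden_split p) fr c5 => [[fa fb fg] c5 | [fa fb fg] c5].
  (* The roots [y] and [- x] of [t ^+ 2 - t - 1] lie in [F]; exactly one is a square, because
     [x = 1 / y] and -1 is a nonresidue. *)
  have [y yE] := rmorph_fixed f fb; have [x xE] := rmorph_fixed f fa.
  have yx : y = x + 1 by apply: (fmorph_inj f); rewrite -yE rmorphD rmorph1 /= -xE.
  have xy : x * y = 1 by apply: (fmorph_inj f); rewrite rmorphM rmorph1 /= -xE -yE.
  have cD : chi (y * (x + y)) = - eps5 p.
    apply: (chi_rmorph oF (f := f)); first by apply: sgn_valN; apply: eps5_sgn.
    rewrite card_Fp // rmorphM rmorphD /= -xE -yE (golden_g_half g2 oh) rmorphN.
    by rewrite (frob_pred (golden_g_neq0 f ba ab g2) fg).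
  have y0 : y != 0.
    by apply: contra_eq_neq xy => ->; rewrite mulr0 eq_sym oner_eq0.
  have cx : chi x = chi y.
    have xE' : x = y^-1 by apply: (mulIf y0); rewrite xy mulVf.
    by rewrite xE' (chiV oF).
  have cNx : chi (- x) = - chi y by rewrite -[- x]mulN1r (chiM oF) N1 cx mulN1r.
  have cNyx : chi (- x - y) = - chi (x + y).
    by rewrite -opprD -[- (x + y)]mulN1r (chiM oF) N1 mulN1r.
  have tE (t : F) : t ^+ 2 - t - 1 = (y - t) * (- x - t) by rewrite -xy yx; ring.
  rewrite (chiM oF) in cD; case: (chi_pm y0) => cy; rewrite cy in cD cNx.
    rewrite (eq_bigr (fun t => chi_nz ((y - t) * (- x - t)))) => [|t _]; last by rewrite tE.
    by rewrite split_square // cNyx -[RHS]opprK -cD mul1r.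
  rewrite (eq_bigr (fun t => chi_nz ((- x - t) * (y - t)))) => [|t _]; last first.
    by rewrite tE mulrC.
  rewrite split_square // opprK addrC.
  by apply: oppr_inj; rewrite -cD mulN1r.
(* No factor vanishes in the inert case, since [2 t - 1] would be a square root of 5. *)
transitivity (chi (\prod_(t : F | chi t == 1) (t ^+ 2 - t - 1))).
  rewrite (chi_prod oF); apply: eq_bigr => t _; rewrite /chi_nz; case: eqP => // t0.
  have t5 : (2 * t - 1) ^+ 2 = 5.
    by transitivity (4 * (t ^+ 2 - t - 1) + 5); [ring | rewrite t0 mulr0 add0r].
  have t10 : 2 * t - 1 != 0.
    by apply/eqP=> t1; move/eqP: t5; rewrite t1 expr0n eq_sym (negPf F5).
  by move: c5; rewrite -t5 (chi_sqr oF).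
apply: (chi_rmorph oF (f := f)).
  by apply: sgn_valM; [apply: sign_sgn | apply: eps5_sgn].
rewrite card_Fp // -(inert_square_half f ba ab g2 fb fg oh); congr (_ ^+ _).
rewrite -(inert_square ab fb oh) rmorph_prod.
rewrite -[p in b ^+ p./2](card_Fp p_pr) -(prod_sub_chi1 oF f).
rewrite -[p in (- a) ^+ p./2](card_Fp p_pr) -(prod_sub_chi1 oF f) -big_split /=.
apply: eq_bigr => t _; rewrite !rmorphB rmorphXn rmorph1 /= -ab ba; ring.
Qed.

End Closure.

(** * Values modulo 16 and periodicity *)

Definition curve_sum (F : finFieldType) (e : F) : int := \sum_y chi (y * (y + 1) * (y + e)).

Section CurveSum.

Variable F : finFieldType.
Hypothesis oddF : odd #|F|.
Implicit Type e : F.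

Lemma curve_sumV e : e != 0 -> curve_sum e^-1 = chi e * curve_sum e.
Proof.
move=> e0; have eV0 : e^-1 != 0 by rewrite invr_eq0.
rewrite /curve_sum mulr_sumr (reindex_inj (mulfI eV0)); apply: eq_bigr => y _.
rewrite -chiM // (_ : e^-1 * y * (e^-1 * y + 1) * (e^-1 * y + e^-1)
  = (e^-1 ^+ 2) ^+ 2 * (e * (y * (y + 1) * (y + e)))); last by field.
by rewrite [LHS]chiM // chi_sqr ?mul1r // expf_neq0.
Qed.

Lemma curve_sumB e : curve_sum (1 - e) = chi (-1 : F) * curve_sum e.
Proof.
rewrite /curve_sum mulr_sumr (reindex_inj (h := fun y => -1 - y)); last first.
  by move=> x y /addrI /oppr_inj.
by apply: eq_bigr => y _; rewrite -chiM //; congr chi; ring.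
Qed.

Lemma curve_sum_sub e :
  \sum_x chi (x * (x - 1) * (x - e)) = chi (-1 : F) * curve_sum e.
Proof.
rewrite /curve_sum mulr_sumr (reindex_inj oppr_inj).
by apply: eq_bigr => y _; rewrite -chiM //; congr chi; ring.
Qed.

End CurveSum.

Lemma sign_odd m n : (-1) ^+ m = (-1) ^+ n :> int -> odd m = odd n.
Proof. by rewrite -signr_odd -[RHS]signr_odd; case: odd; case: odd. Qed.

(* By [prod_triangle_even] and [prod_triangle_sym], every product over i < j
   considered here has this shape. *)
Definition residue_prod (p : nat) (a c : int) : int :=
  \prod_(x : 'F_p | (chi x == 1) && (chi (x - 1) == -1)) chi_nz (a%:~R * x + c%:~R).

Section Values.

Variable p : nat.
Hypotheses (p_pr : prime p) (p_gt5 : (5 < p)%N).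

Let p_gt2 : (2 < p)%N. Proof. by apply: leq_trans p_gt5. Qed.
Local Notation F := 'F_p.
Local Notation oF := (odd_card_Fp p_pr p_gt2).
Local Notation S5 := (curve_sum (5 : F)).
Local Notation a := (chi (-1 : F)).
Local Notation c := (chi (5 : F)).

Let F2 : (2 : F) != 0. Proof. by apply: (Fp_nat_neq0 p_pr (n := 2)); lia. Qed.
Let F4 : (4 : F) != 0. Proof. by apply: (Fp_nat_neq0 p_pr (n := 4)); lia. Qed.
Let F5 : (5 : F) != 0. Proof. by apply: (Fp_nat_neq0 p_pr (n := 5)); lia. Qed.

Lemma chiN1_pm : a = 1 \/ a = -1.
Proof. by apply: chi_pm; rewrite oppr_eq0 oner_eq0. Qed.

Lemma chi5_pm : c = 1 \/ c = -1.
Proof. exact: chi_pm. Qed.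

Lemma chi_four : chi (4 : F) = 1.
Proof. by rewrite (_ : 4 = 2 ^+ 2) ?(chi_sqr oF) //; ring. Qed.

Lemma chi_opp (x : F) : chi (- x) = a * chi x.
Proof. by rewrite -(chiM oF) mulN1r. Qed.

(** This is [card_pattern] at [e = 1 / 5], for the pattern whose parity is given by [core_count]. *)
Lemma curve_sum_core : exists2 n : nat,
    (-1) ^+ n = core_sign p * (-1) ^+ p./2./2 &
    (n * 8)%:Z = p%:Z + a + a * c - c + a * S5 - 2 * (1 - a).
Proof.
set n := #|[set x : F | pattern 1 (- a) (- chi (-5 : F)) (5^-1) x]|.
exists n; first exact: core_count.
have N1 : (-1 : F) != 0 by rewrite oppr_eq0 oner_eq0.
have sN (x : F) : sgn_val (- chi x) by apply: sgn_valN; apply: chi_sgn.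
have e1 : (5^-1 : F) != 1.
  rewrite -subr_eq0 (_ : 5^-1 - 1 = - 4 * 5^-1); last by field.
  by rewrite mulf_neq0 ?oppr_eq0 // invr_eq0.
have c0 : c != 0 by rewrite chi_eq0.
rewrite /n (card_pattern oF) //; first last.
- by rewrite invr_eq0.
- by rewrite oppr_eq0 chi_eq0 oppr_eq0.
- by rewrite oppr_eq0 chi_eq0.
- by constructor 2.
rewrite (curve_sum_sub oF) (curve_sumV oF) // (chi_opp 5) (chi_opp 5^-1).
rewrite (_ : 1 - 5^-1 = 4 * 5^-1 :> F); last by field.
rewrite (_ : 5^-1 - 1 = - (4 * 5^-1) :> F); last by field.
rewrite (chi_opp (4 * _)) (chiM oF) (chiV oF) chi_four mul1r card_Fp //.
by case: chiN1_pm => ->; case: chi5_pm => ->; ring.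
Qed.

(** As [al * x + ga = al * (x - e)], the factor is -1 exactly where [chi (x - e) = - chi al], so the
    exponent is a pattern count. *)
Lemma residue_prod_count (al ga : F) : al != 0 -> ga != 0 -> al + ga != 0 ->
  exists2 n : nat,
    \prod_(x : F | (chi x == 1) && (chi (x - 1) == -1)) chi_nz (al * x + ga) = (-1) ^+ n &
    (n * 8)%:Z = p%:Z + 1 + chi al * a * curve_sum (- (ga / al))
      - (1 - a) * (1 - chi ga) - 2 * (1 - chi (al + ga))
      - (1 + a * chi al * chi ga) * (1 - a * chi al * chi (al + ga)).
Proof.
move=> al0 ga0 ag0; set e := - (ga / al).
have N1 : (-1 : F) != 0 by rewrite oppr_eq0 oner_eq0.
exists #|[set x : F | pattern 1 (-1) (- chi al) e x]|.
  rewrite -prod_const_card big_mkcond [RHS]big_mkcond; apply: eq_bigr => x _.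
  have E : al * x + ga = al * (x - e) by rewrite /e; field.
  rewrite /pattern andbA; case: (_ && _) => //=; rewrite E /chi_nz mulf_eq0 (negPf al0).
  rewrite (chiM oF) /=; have [->|xe] := eqVneq (x - e) 0.
    by rewrite chi0 eq_sym oppr_eq0 chi_eq0 (negPf al0).
  by case: (chi_pm al0) => ->; case: (chi_pm xe) => ->.
rewrite (card_pattern oF) //; first last.
- by rewrite -subr_eq0 (_ : e - 1 = - ((al + ga) / al)) ?oppr_eq0 ?mulf_neq0 ?invr_eq0 // /e; field.
- by rewrite oppr_eq0 mulf_neq0 ?invr_eq0.
- by rewrite oppr_eq0 chi_eq0.
- by apply: sgn_valN; apply: chi_sgn.
- by constructor 3.
- by constructor 2.
rewrite (curve_sum_sub oF) (_ : 1 - e = (al + ga) / al); last by rewrite /e; field.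
rewrite (_ : - e = ga / al); last by rewrite opprK.
rewrite (_ : e - 1 = - ((al + ga) / al)); last by rewrite /e; field.
rewrite {2}/e (chi_opp (ga / al)) (chi_opp (_ / al)) !(chiM oF) !(chiV oF) card_Fp //.
by case: (chi_pm al0) => ->; case: (chi_pm ga0) => ->; ring.
Qed.

Lemma prod_triangle_even (al ga : int) :
  prod_triangle (al, 0, ga) p = residue_prod p al ga.
Proof.
rewrite prod_triangle_Fp // /residue_prod -triangle_even //.
by apply: eq_bigr => j _; apply: eq_bigr => i _; rewrite mul0r addr0.
Qed.

Lemma prod_triangle_sym (al be : int) :
  prod_triangle (al, be, al) p = residue_prod p (2 * al - be) (2 * al + be).
Proof.
rewrite prod_triangle_Fp // /residue_prod triangle_sym //.
by rewrite rmorphB rmorphD !rmorphM.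
Qed.

Lemma curve_sumN4 : curve_sum (-4 : F) = a * S5.
Proof. by rewrite -(curve_sumB oF); congr curve_sum; ring. Qed.

Lemma prod_square_val : prod_square (1, -1, -1) p = square_sign p.
Proof.
rewrite prod_square_Fp // square_product //.
transitivity (\prod_(t : F | chi (- t) == -1) chi_nz (t ^+ 2 - t - 1)).
  by apply: eq_bigr => t _; rewrite /= !rmorphN1 rmorph1 mul1r mulN1r.
by case: (boolP (odd p./2)); [exact: square_odd | exact: square_even].
Qed.

End Values.

(** The multiplier [u] is chosen before [p], so it takes the same value at primes with the same
    characters of -1 and 5. *)
Lemma F01_linear n : n \in [:: 5; -4; 1 / 5; 4 / 5; 5 / 4; - (1 / 4)] ->
  exists u : int -> int -> int, forall p, prime p -> (5 < p)%N ->
    F01 p n = u (chi (-1 : 'F_p)) (chi (5 : 'F_p)) * curve_sum (5 : 'F_p).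
Proof.
have E p (p_pr : prime p) (p_gt5 : (5 < p)%N) (n' : rat) (x y : int) :
    numq n' = x -> denq n' = y -> F01 p n' = curve_sum (x%:~R / y%:~R : 'F_p).
  by move=> <- <-; rewrite F01E //; apply: leq_trans p_gt5.
pose oF p p_pr p_gt5 : odd #|'F_p| := odd_card_Fp p_pr (leq_trans (isT : (2 < 6)%N) p_gt5).
have F5 p : prime p -> (5 < p)%N -> (5 : 'F_p) != 0.
  by move=> p_pr p_gt5; apply: (Fp_nat_neq0 p_pr (n := 5)); lia.
have F4 p : prime p -> (5 < p)%N -> (4 : 'F_p) != 0.
  by move=> p_pr p_gt5; apply: (Fp_nat_neq0 p_pr (n := 4)); lia.
(* An inversion followed by a reflection: [4 / 5 = 1 - 5^-1]. *)
have c15 p (p_pr : prime p) (p_gt5 : (5 < p)%N) :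
    curve_sum (4 / 5 : 'F_p) = chi (-1 : 'F_p) * (chi (5 : 'F_p) * curve_sum (5 : 'F_p)).
  have := F5 p p_pr p_gt5 => f5.
  rewrite -(curve_sumV (oF _ p_pr p_gt5)) // -(curve_sumB (oF _ p_pr p_gt5)).
  by congr curve_sum; field.
rewrite !inE => /or4P[||| /or3P[||]] /eqP ->.
- exists (fun _ _ => 1) => p p_pr p_gt5; rewrite (E p _ _ _ 5 1) //.
  by rewrite divr1 mul1r.
- exists (fun a _ => a) => p p_pr p_gt5; rewrite (E p _ _ _ (-4) 1) //.
  by rewrite divr1 rmorphN /= curve_sumN4.
- exists (fun _ c => c) => p p_pr p_gt5; rewrite (E p _ _ _ 1 5) //.
  by rewrite mul1r (curve_sumV (oF _ p_pr p_gt5)) ?F5.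
- exists (fun a c => a * c) => p p_pr p_gt5; rewrite (E p _ _ _ 4 5) //.
  by rewrite c15 // mulrA.
- exists (fun a c => c * (a * c)) => p p_pr p_gt5; rewrite (E p _ _ _ 5 4) //.
  have n0 : (4 / 5 : 'F_p) != 0 by rewrite mulf_neq0 ?invr_eq0 ?F5 ?F4.
  rewrite -(invf_div 4%:~R) (curve_sumV (oF _ p_pr p_gt5) n0).
  rewrite c15 // (chiM (oF _ p_pr p_gt5)) (chiV (oF _ p_pr p_gt5)) chi_four // mul1r.
  by rewrite !mulrA.
- exists (fun a c => a * a) => p p_pr p_gt5; rewrite (E p _ _ _ (-1) 4) //.
  rewrite (_ : (-1)%:~R / 4%:~R = (-4)^-1); last first.
    by rewrite invrN mulN1r.
  have n0 : (-4 : 'F_p) != 0 by rewrite oppr_eq0 F4.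
  rewrite (curve_sumV (oF _ p_pr p_gt5) n0) (curve_sumN4 p_pr p_gt5).
  by rewrite (chi_opp p_pr p_gt5) chi_four // mulr1 mulrA.
Qed.

(** The parameter [- (ga / al)] is 1/5, 5, -1/4, -4 and 5 respectively, and [al + ga] is 4, 5 or -4,
    so every sign involved is a function of the characters of -1 and 5. *)
Lemma residue_prod_linear al ga :
  (al, ga) \in [:: (5, -1); (-1, 5); (4, 1); (1, 4); (1, -5)] ->
  exists u k : int -> int -> int, forall p, prime p -> (5 < p)%N ->
    exists2 n : nat, residue_prod p al ga = (-1) ^+ n &
      (n * 8)%:Z = p%:Z + u (chi (-1 : 'F_p)) (chi (5 : 'F_p)) * curve_sum (5 : 'F_p)
                   + k (chi (-1 : 'F_p)) (chi (5 : 'F_p)).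
Proof.
(* Here [A], [G], [H] stand for the characters of [al], [ga], [al + ga], and [k] gathers the
   elementary terms of [residue_prod_count]. *)
pose k (A G H : int -> int -> int) := fun a c : int => 1 - (1 - a) * (1 - G a c)
  - 2 * (1 - H a c) - (1 + a * A a c * G a c) * (1 - a * A a c * H a c).
have core (A G H u : int -> int -> int) :
    (forall p, prime p -> (5 < p)%N ->
      let a := chi (-1 : 'F_p) in let c := chi (5 : 'F_p) in
      [/\ chi (al%:~R : 'F_p) = A a c, chi (ga%:~R : 'F_p) = G a c,
          chi (al%:~R + ga%:~R : 'F_p) = H a c,
          [&& A a c != 0, G a c != 0 & H a c != 0] &
          curve_sum (- (ga%:~R / al%:~R) : 'F_p) = u a c * curve_sum (5 : 'F_p)]) ->
  exists u k : int -> int -> int, forall p, prime p -> (5 < p)%N ->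
    exists2 n : nat, residue_prod p al ga = (-1) ^+ n &
      (n * 8)%:Z = p%:Z + u (chi (-1 : 'F_p)) (chi (5 : 'F_p)) * curve_sum (5 : 'F_p)
                   + k (chi (-1 : 'F_p)) (chi (5 : 'F_p)).
  move=> H0; exists (fun a c => A a c * a * u a c), (k A G H) => p p_pr p_gt5.
  have [eA eG eH /and3P[A0 G0 H1] eu] := H0 p p_pr p_gt5.
  rewrite -eA chi_eq0 in A0; rewrite -eG chi_eq0 in G0; rewrite -eH chi_eq0 in H1.
  have [n nE n8] := residue_prod_count p_pr p_gt5 A0 G0 H1.
  by exists n => //; rewrite n8 eA eG eH eu /k; ring.
pose oF p p_pr p_gt5 : odd #|'F_p| := odd_card_Fp p_pr (leq_trans (isT : (2 < 6)%N) p_gt5).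
have F5 p : prime p -> (5 < p)%N -> (5 : 'F_p) != 0.
  by move=> p_pr p_gt5; apply: (Fp_nat_neq0 p_pr (n := 5)); lia.
have F4 p : prime p -> (5 < p)%N -> (4 : 'F_p) != 0.
  by move=> p_pr p_gt5; apply: (Fp_nat_neq0 p_pr (n := 4)); lia.
have nz p : prime p -> (5 < p)%N ->
    (chi (-1 : 'F_p) != 0) && (chi (5 : 'F_p) != 0).
  by move=> p_pr p_gt5; rewrite !chi_eq0 oppr_eq0 oner_eq0 F5.
have e4 p (p_pr : prime p) (p_gt5 : (5 < p)%N) := chi_four p_pr p_gt5.
rewrite !inE => mem; move: core; case/or4P: mem => [||| /orP[]] /eqP[-> ->] core.
- apply: (core (fun _ c => c) (fun a _ => a) (fun _ _ => 1) (fun _ c => c)) => p p_pr p_gt5 /=.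
  have := nz p p_pr p_gt5; rewrite rmorphN1 => /andP[-> ->]; split=> //.
    by rewrite (_ : 5%:~R + -1 = 4 :> 'F_p) ?e4 //; ring.
  by rewrite mulN1r opprK (curve_sumV (oF _ p_pr p_gt5)) ?F5.
- apply: (core (fun a _ => a) (fun _ c => c) (fun _ _ => 1) (fun _ _ => 1)) => p p_pr p_gt5 /=.
  have := nz p p_pr p_gt5; rewrite rmorphN1 => /andP[-> ->]; split=> //.
    by rewrite (_ : -1 + 5%:~R = 4 :> 'F_p) ?e4 //; ring.
  by rewrite invrN1 mulrN1 opprK mul1r.
- apply: (core (fun _ _ => 1) (fun _ _ => 1) (fun _ c => c) (fun a _ => a * a)) => p p_pr p_gt5 /=.
  have := nz p p_pr p_gt5; rewrite rmorph1 => /andP[a0 ->]; split=> //.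
  - exact: e4.
  - exact: chi1.
  - by rewrite (_ : 4%:~R + 1 = 5 :> 'F_p) //; ring.
  have n0 : (-4 : 'F_p) != 0 by rewrite oppr_eq0 F4.
  rewrite mul1r -invrN (curve_sumV (oF _ p_pr p_gt5) n0) (curve_sumN4 p_pr p_gt5).
  by rewrite (chi_opp p_pr p_gt5) e4 // mulr1 mulrA.
- apply: (core (fun _ _ => 1) (fun _ _ => 1) (fun _ c => c) (fun a _ => a)) => p p_pr p_gt5 /=.
  have := nz p p_pr p_gt5; rewrite rmorph1 => /andP[a0 ->]; split=> //.
  - exact: chi1.
  - exact: e4.
  by rewrite divr1 curve_sumN4.
apply: (core (fun _ _ => 1) (fun a c => a * c) (fun a _ => a) (fun _ _ => 1)) => p p_pr p_gt5 /=.
have := nz p p_pr p_gt5; rewrite rmorph1 => /andP[a0 c0]; split=> //.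
- exact: chi1.
- by rewrite rmorphN (chi_opp p_pr p_gt5).
- rewrite rmorphN (_ : 1 - 5%:~R = - 4 :> 'F_p); last by ring.
  by rewrite (chi_opp p_pr p_gt5) e4 // mulr1.
- by rewrite mulf_neq0.
by rewrite divr1 rmorphN opprK mul1r.
Qed.

(** * Dependence on [p] modulo 80 *)

Section Congruence.

Variables p q : nat.
Hypotheses (p_pr : prime p) (p_gt5 : (5 < p)%N) (q_pr : prime q) (q_gt5 : (5 < q)%N).
Hypothesis pq : p = q %[mod 80].

Lemma golden_split_mod : golden_split p = golden_split q.
Proof. by rewrite /golden_split; have -> : (p %% 5 = q %% 5)%N by lia. Qed.

Lemma eps5_mod : eps5 p = eps5 q.
Proof. by rewrite /eps5; have -> : (p %% 5 = q %% 5)%N by lia. Qed.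

Lemma odd_half_mod : odd p./2 = odd q./2.
Proof. lia. Qed.

Lemma sign_quarter_mod : (-1) ^+ p./2./2 = (-1) ^+ q./2./2 :> int.
Proof.
by rewrite -signr_odd -[RHS]signr_odd; have -> : odd p./2./2 = odd q./2./2 by lia.
Qed.

Lemma chiN1_mod : chi (-1 : 'F_p) = chi (-1 : 'F_q).
Proof. by rewrite !chi_N1_odd // odd_half_mod. Qed.

Lemma chi5_mod : chi (5 : 'F_p) = chi (5 : 'F_q).
Proof. by rewrite !chi_five // /chi5_val golden_split_mod. Qed.

Lemma core_sign_mod : core_sign p = core_sign q.
Proof.
rewrite /core_sign odd_half_mod golden_split_mod eps5_mod sign_quarter_mod /chi2_val.
by have -> : (p %% 8 = q %% 8)%N by lia.
Qed.

Lemma square_sign_mod : square_sign p = square_sign q.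
Proof.
rewrite /square_sign /chi5_val odd_half_mod golden_split_mod eps5_mod sign_quarter_mod.
by have -> : odd p./2./2 = odd q./2./2 by lia.
Qed.

(** The counts [n] and [m] have the same parity, so [8 n] and [8 m] agree modulo 16, and [p] and [q]
    do too. Together with the classes modulo 5 that fix the signs, this accounts for the modulus
    80. *)
Lemma curve_sum_mod : (curve_sum (5%R : 'F_p) = curve_sum (5%R : 'F_q) %[mod 16])%Z.
Proof.
have [n ns n8] := curve_sum_core p_pr p_gt5; have [m ms m8] := curve_sum_core q_pr q_gt5.
have nm : odd n = odd m by apply: sign_odd; rewrite ns ms core_sign_mod sign_quarter_mod.
move: n8 m8; rewrite -chiN1_mod -chi5_mod.
move: (curve_sum _) (curve_sum _) => x y.
by case: (chiN1_pm p) => ->; case: (chi5_pm p_pr p_gt5) => -> n8 m8; lia.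
Qed.

Lemma linear_mod (u k : int) (n m : nat) :
  (n * 8)%:Z = p%:Z + u * curve_sum (5 : 'F_p) + k ->
  (m * 8)%:Z = q%:Z + u * curve_sum (5 : 'F_q) + k -> (-1) ^+ n = (-1) ^+ m :> int.
Proof.
move: curve_sum_mod; move: (curve_sum _) (curve_sum _) => x y xy n8 m8.
have /dvdzP[d dE] : (16 %| u * (x - y))%Z.
  by apply: dvdz_mull; rewrite -eqz_mod_dvd; apply/eqP.
rewrite -signr_odd -[RHS]signr_odd; have -> // : odd n = odd m.
by rewrite mulrBr in dE; lia.
Qed.

Lemma residue_prod_mod (al ga : int) :
  (al, ga) \in [:: (5, -1); (-1, 5); (4, 1); (1, 4); (1, -5)] ->
  residue_prod p al ga = residue_prod q al ga.
Proof.
move=> /residue_prod_linear[u [k uk]].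
have [n -> n8] := uk p p_pr p_gt5; have [m -> m8] := uk q q_pr q_gt5.
by apply: linear_mod n8 _; rewrite chiN1_mod chi5_mod.
Qed.

Lemma F01_mod16 n : n \in [:: 5; -4; 1 / 5; 4 / 5; 5 / 4; - (1 / 4)] ->
  (F01 p n = F01 q n %[mod 16])%Z.
Proof.
move=> /F01_linear[u uE]; rewrite !uE // chiN1_mod chi5_mod.
by rewrite -modzMmr curve_sum_mod modzMmr.
Qed.

End Congruence.

(* The prime 5 is alone in its class modulo 80. *)
Lemma periodic80 (g : prime_fun) :
  (forall p, pdom g p -> (3 < p)%N) ->
  (forall p q, prime p -> (5 < p)%N -> prime q -> (5 < q)%N -> p = q %[mod 80] -> g p = g q) ->
  periodic g.
Proof.
move=> dom gmod; exists 80%N => // p q p_pr q_pr /dom p3 /dom q3 pq.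
have prime_gt5 r : prime r -> (3 < r)%N -> r = 5%N \/ (5 < r)%N.
  by case: r => [|[|[|[|[|[|r]]]]]] //; [left | right].
have five r : prime r -> (5 %| r)%N -> r = 5%N.
  by move=> r_pr; rewrite dvdn_prime2 // => /eqP.
case: (prime_gt5 p p_pr p3) => [pE | p5].
  by rewrite (five q q_pr) ?pE // /dvdn; apply/eqP; lia.
case: (prime_gt5 q q_pr q3) => [qE | q5]; last exact: gmod.
by rewrite (five p p_pr) ?qE // /dvdn; apply/eqP; lia.
Qed.

Lemma periodic_equivalent (g k : prime_fun) : periodic g -> periodic k -> equivalent g k.
Proof.
(* The factor 2 makes the modulus exceed 1. *)
move=> [m m0 gm] [n n0 kn]; exists (2 * (m * n))%N.
  by have := muln_gt0 m n; rewrite m0 n0; lia.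
move=> r _ _.
have red p q : p = q %[mod 2 * (m * n)] -> p = q %[mod m] /\ p = q %[mod n].
  have dm : (m %| 2 * (m * n))%N by rewrite dvdn_mull // dvdn_mulr.
  have dn : (n %| 2 * (m * n))%N by rewrite dvdn_mull // dvdn_mull.
  move=> e; split; first by rewrite -(modn_dvdm p dm) e modn_dvdm.
  by rewrite -(modn_dvdm p dn) e modn_dvdm.
(* If the class contains a prime of both domains, that prime determines the constant term; otherwise
   any polynomial of degree one will do. *)
case: (Classical_Prop.classic (exists p, [/\ prime p, pdom g p, pdom k p &
    p = r %[mod 2 * (m * n)]])) => [[p [p_pr gp kp pr]] | none].
  exists ('X + (g p - k p)%:~R%:P); first by rewrite size_XaddC.
  move=> q q_pr gq kq qr; have [qm qn] := red q p (etrans qr (esym pr)).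
  by rewrite (gm q p) // (kn q p) // hornerD hornerX hornerC rmorphB addrC subrK.
exists 'X; first by rewrite size_polyX.
by move=> q q_pr gq kq qr; case: none; exists q.
Qed.

Theorem theorem3p6 :
  let forms : seq (int * int * int) :=
    [:: (1, 1, -1); (1, 3, 1); (1, -3, 1); (4, 0, 1); (1, 0, 4);
        (5, 0, -1); (1, 0, -5)] in
  let form3 : int * int * int := (1, -1, -1) in
  [/\ (* (i) *)
      forall n1 n2 : rat,
        n1 \in [:: 5; -4; 1 / 5; 4 / 5; 5 / 4; - (1 / 4)] ->
        n2 \in [:: 5; -4; 1 / 5; 4 / 5; 5 / 4; - (1 / 4)] ->
        equivalent (F01mod16 n1) (F01mod16 n2),
      (* (ii) *)
      forall f, f \in forms -> equivalent (F01mod16 5) (prod_triangle f),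
      (* (iii) *)
      equivalent (F01mod16 5) (prod_square form3) &
      (* (iv) *)
      [/\ periodic (F01mod16 5),
          forall f, f \in forms -> periodic (prod_triangle f) &
          periodic (prod_square form3)]].
Proof.
move=> forms form3.
have pF n : n \in [:: 5; -4; 1 / 5; 4 / 5; 5 / 4; - (1 / 4)] -> periodic (F01mod16 n).
  move=> n_in; apply: periodic80 => [p /andP[] // | p q p_pr p5 q_pr q5 pq].
  exact: F01_mod16.
have pT f : f \in forms -> periodic (prod_triangle f).
  move=> f_in; apply: periodic80 => // p q p_pr p5 q_pr q5 pq.
  have R := residue_prod_mod p_pr p5 q_pr q5 pq.
  move: f_in; rewrite /forms !inE => /or4P[||| /or4P[]] /eqP ->.
  (* The shear makes [(1, 1, -1)] symmetric; [2 * al - be] and [2 * al + be] then give the pair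
     [(5, -1)]. *)
  - by rewrite !prod_triangle_shear !prod_triangle_sym //; apply: R.
  - by rewrite !prod_triangle_sym //; apply: R.
  - by rewrite !prod_triangle_sym //; apply: R.
  - by rewrite !prod_triangle_even //; apply: R.
  - by rewrite !prod_triangle_even //; apply: R.
  - by rewrite !prod_triangle_even //; apply: R.
  - by rewrite !prod_triangle_even //; apply: R.
have pS : periodic (prod_square form3).
  apply: periodic80 => // p q p_pr p5 q_pr q5 pq.
  by rewrite !prod_square_val //; apply: square_sign_mod.
have p5 : periodic (F01mod16 5) by apply: pF.
split=> // [n1 n2 i1 i2 | f f_in | ]; apply: periodic_equivalent => //.
- exact: pF.
- exact: pF.
- exact: pT.
Qed.
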